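(* For $N\in[G_{n+1},G_{n+2})$ let $k(N)$ denote the number of nonzero digits in the legal decomposition of $N$. Let $C_{\rm Lek}=1-\pi^Q_1(0)$, let $g:{\cal L}\to\{0,1\}$ be defined by $g(x,j,j')=1$ if and only if $x>0$, let $\tilde g=g-E_{\pi^Q}g$, and $\sigma^2=E_{\pi^Q}\left[\tilde g\,((2Q^{\#}-I)\tilde g)\right]$. Then: 1. (Law of Large Numbers) For every $\epsilon>0$, $\displaystyle\lim_{n\to\infty}Q_n\left(\left|k(N)-C_{\rm Lek}(n+1)\right|>n\epsilon\right)=0$. 2. (Central Limit Theorem) The distribution of $\dfrac{k(N)-C_{\rm Lek}(n+1)}{\sqrt{n+1}}$ under $Q_n$ converges weakly to $N(0,\sigma^2)$ as $n\to\infty$.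
   Context: $\mathbb{Z}_+=\{0,1,\dots\}$. Fix $L\in\mathbb{N}$ and $c_1,\dots,c_L\in\mathbb{Z}_+$ with $c_1c_L>0$ and $(L,c_1)\ne(1,1)$. The positive linear recursion $(G_n)_{n\ge1}$ is: $G_1=1$; $G_{n+1}=c_1G_n+c_2G_{n-1}+\dots+c_nG_1+1$ for $1\le n\le L-1$; $G_{n+1}=\sum_{j=1}^Lc_jG_{n+1-j}$ for $n\ge L$. An expression $N=\sum_{i=1}^na_iG_{n+1-i}$ with $a_1\in\mathbb{N}$, $a_2,\dots,a_n\in\mathbb{Z}_+$ is a legal decomposition of length $n$ if either (i) $n<L$ and $a_i=c_i$ for $1\le i\le n$; or (ii) there is $s\in\{1,\dots,L\}$ with $a_1=c_1,\dots,a_{s-1}=c_{s-1}$, $a_s<c_s$, $a_{s+1}=\dots=a_{s+\ell}=0$ for some $\ell\ge0$, and $(a_{s+\ell+i})_{i=1}^{n-s-\ell}$ is either (the digit sequence of) a legal decomposition or empty. It is known that every positive integer has a unique legal decomposition, and the integers in $[G_n,G_{n+1})$ are exactly those whose legal decomposition has length $n$. The $a_i$ are the digits. $Q_n$ ($n\in\mathbb{Z}_+$) denotes the uniform distribution on the integers $N\in[G_{n+1},G_{n+2})$ (those with $n+1$ digits). Let $${\cal L}=\{(x,j,j'): (x<c_j \text{ and } j'=1)\text{ or }(j<L,\ x=c_j,\ j'=j+1)\},$$ with $x\in\{0,\dots,\max_ic_i\}$, $j,j'\in\{1,\dots,L\}$. $P_{\cal L}$ is the ${\cal L}\times{\cal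 L}$ matrix with entry $\frac{1}{(\max_ic_i+1)L}$ at $(z,z')$ if the third coordinate of $z$ equals the second coordinate of $z'$, and $0$ otherwise; it is irreducible and aperiodic. $\lambda_c$ is its Perron eigenvalue, with positive left and right eigenvectors $\nu_c,\varphi_c$ normalized so that $\varphi_c$ and $\nu_c\varphi_c$ are probability distributions on ${\cal L}$. $Q(z,z')=\frac{1}{\lambda_c\varphi_c(z)}P_{\cal L}(z,z')\varphi_c(z')$ is an irreducible aperiodic stochastic matrix with stationary distribution $\pi^Q=\nu_c\varphi_c$; $\pi^Q_1(x)=\sum_{b,b'}\pi^Q(x,b,b')$. $E_{\pi^Q}h=\sum_z\pi^Q(z)h(z)$. $Q^{\#}$ is the inverse of $I-Q$ on $\{h:E_{\pi^Q}h=0\}$, extended linearly to all functions on ${\cal L}$ by $Q^{\#}\mathbf 1=0$; products of functions are pointwise. *)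

(* Defs.v *)
From HB Require Import structures.
From mathcomp Require Import all_boot all_order all_algebra.
From mathcomp Require Import all_classical all_reals all_analysis.
From mathcomp Require Import complex.

Set Implicit Arguments.
Unset Strict Implicit.
Unset Printing Implicit Defensive.

Import Order.TTheory GRing.Theory Num.Theory.
Import numFieldNormedType.Exports.

Local Open Scope classical_set_scope.
Local Open Scope ring_scope.

(* The coefficients c_1, ..., c_L and the sequence G_1, G_2, ... are functions
   nat -> nat indexed from 1; the values c 0, c j for j > L, and G 0 are junk
   and are never used. *)

Definition PLR_coef (L : nat) (c : nat -> nat) : Prop :=
  [/\ (0 < L)%N, (0 < c 1 * c L)%N & (L, c 1) <> (1%N, 1%N)].

Definition is_PLR (L : nat) (c G : nat -> nat) : Prop :=
  [/\ G 1%N = 1%N,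
      (forall n, (1 <= n < L)%N ->
         G n.+1 = (\sum_(1 <= j < n.+1) c j * G (n.+1 - j) + 1)%N)
    & (forall n, (L <= n)%N ->
         G n.+1 = (\sum_(1 <= j < L.+1) c j * G (n.+1 - j))%N)].

(* A digit sequence a_1, ..., a_n is the list [:: a_1; ...; a_n], so that
   a_i = nth 0 a i.-1.  In case (ii), d is the digit a_s. *)
Inductive legal (L : nat) (c : nat -> nat) : seq nat -> Prop :=
| legal_i (a : seq nat) :
    (0 < size a < L)%N -> (0 < head 0 a)%N ->
    (forall i, (i < size a)%N -> nth 0%N a i = c i.+1) ->
    legal L c a
| legal_ii (s d l : nat) (t : seq nat) :
    (1 <= s <= L)%N -> (d < c s)%N -> (t <> [::] -> legal L c t) ->
    (0 < head 0 ([seq c j | j <- iota 1 s.-1] ++ d :: nseq l 0 ++ t))%N ->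
    legal L c ([seq c j | j <- iota 1 s.-1] ++ d :: nseq l 0 ++ t).

Definition digits_value (G : nat -> nat) (a : seq nat) : nat :=
  \sum_(1 <= i < (size a).+1) (nth 0 a i.-1 * G ((size a).+1 - i)).

(* The legal decomposition of N; the default [::] is only reached at N = 0. *)
Definition legal_decomposition (L : nat) (c G : nat -> nat) (N : nat) : seq nat :=
  xget [::] [set a | legal L c a /\ N = digits_value G a].

Definition nb_nonzero_digits (L : nat) (c G : nat -> nat) (N : nat) : nat :=
  count (fun d => d != 0)%N (legal_decomposition L c G N).

Definition cmax (L : nat) (c : nat -> nat) : nat := \max_(1 <= j < L.+1) c j.

(* An index j in {1, ..., L} is the ordinal j - 1 in 'I_L. *)
Definition in_LL (L : nat) (c : nat -> nat)
    (z : 'I_(cmax L c).+1 * 'I_L * 'I_L) : bool :=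
  let x := nat_of_ord z.1.1 in
  let j := (nat_of_ord z.1.2).+1 in
  let j' := (nat_of_ord z.2).+1 in
  ((x < c j) && (j' == 1) || [&& j < L, x == c j & j' == j.+1])%N.

Definition LL (L : nat) (c : nat -> nat) : finType :=
  {z : 'I_(cmax L c).+1 * 'I_L * 'I_L | in_LL z}.

Definition LLx (L : nat) (c : nat -> nat) (z : LL L c) : nat := (val z).1.1.
Definition LLj (L : nat) (c : nat -> nat) (z : LL L c) : 'I_L := (val z).1.2.
Definition LLj' (L : nat) (c : nat -> nat) (z : LL L c) : 'I_L := (val z).2.

(* LL x LL matrices and functions on LL are matrices and column vectors of
   dimension #|LL|; the index i stands for the element enum_val i of LL. *)
Definition P_LL (R : realType) (L : nat) (c : nat -> nat) : 'M[R]_#|LL L c| :=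
  \matrix_(i, i') if LLj' (enum_val i) == LLj (enum_val i')
                  then (((cmax L c).+1 * L)%:R)^-1 else 0.

(* Eigenvalue of a real matrix which dominates the whole complex spectrum. *)
Definition is_perron_eigenvalue (R : realType) (m : nat)
    (A : 'M[R]_m) (lambda : R) : Prop :=
  eigenvalue A lambda /\
  forall mu : R[i], eigenvalue (map_mx (real_complex R) A) mu ->
    `|mu| <= real_complex R lambda.

Definition is_perron_data (R : realType) (m : nat) (A : 'M[R]_m)
    (lambda : R) (nu : 'rV[R]_m) (phi : 'cV[R]_m) : Prop :=
  [/\ is_perron_eigenvalue A lambda,
      nu *m A = lambda *: nu /\ A *m phi = lambda *: phi,
      (forall i, 0 < nu 0 i) /\ (forall i, 0 < phi i 0),
      \sum_i phi i 0 = 1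
    & \sum_i nu 0 i * phi i 0 = 1].

Definition doob_transform (R : realType) (m : nat) (A : 'M[R]_m)
    (lambda : R) (phi : 'cV[R]_m) : 'M[R]_m :=
  \matrix_(i, i') ((lambda * phi i 0)^-1 * A i i' * phi i' 0).

Definition pi_Q (R : realType) (m : nat)
    (nu : 'rV[R]_m) (phi : 'cV[R]_m) : 'rV[R]_m :=
  \row_i (nu 0 i * phi i 0).

Definition expect (R : realType) (m : nat)
    (p : 'rV[R]_m) (h : 'cV[R]_m) : R := \sum_i p 0 i * h i 0.

Definition pi_Q1 (R : realType) (L : nat) (c : nat -> nat)
    (p : 'rV[R]_#|LL L c|) (x : nat) : R :=
  \sum_(i | LLx (enum_val i) == x) p 0 i.

(* Qs preserves {h | expect p h = 0}, is a two-sided inverse of I - Q there,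
   and kills the constants. *)
Definition is_Qsharp (R : realType) (m : nat)
    (Q : 'M[R]_m) (p : 'rV[R]_m) (Qs : 'M[R]_m) : Prop :=
  Qs *m const_mx 1 = 0 :> 'cV[R]_m /\
  forall h : 'cV[R]_m, expect p h = 0 ->
    [/\ expect p (Qs *m h) = 0,
        (1%:M - Q) *m (Qs *m h) = h
      & Qs *m ((1%:M - Q) *m h) = h].

Definition g_pos (R : realType) (L : nat) (c : nat -> nat) : 'cV[R]_#|LL L c| :=
  \col_i (0 < LLx (enum_val i))%N%:R.

Definition center (R : realType) (m : nat)
    (p : 'rV[R]_m) (h : 'cV[R]_m) : 'cV[R]_m := h - const_mx (expect p h).

Definition pointwise_mul (R : realType) (m : nat)
    (h h' : 'cV[R]_m) : 'cV[R]_m := \col_i (h i 0 * h' i 0).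

Definition sigma2 (R : realType) (m : nat)
    (p : 'rV[R]_m) (Qs : 'M[R]_m) (g : 'cV[R]_m) : R :=
  let gt := center p g in
  expect p (pointwise_mul gt ((2%:R *: Qs - 1%:M) *m gt)).

(* Normalized counting measure of {N | G_{n+1} <= N < G_{n+2}}. *)
Definition Q_unif (R : realType) (G : nat -> nat) (n : nat) :
    {measure set nat -> \bar R} :=
  let K := (G n.+2 - G n.+1)%N in
  mscale (K%:R^-1)%:nng (msum (fun i => \d_(G n.+1 + i)%N) K).

(* The normal distribution N(0, v).  The library's [normal_prob 0 0] is not the
   point mass at 0, hence the case distinction. *)
Definition normal0 (R : realType) (v : R) : probability (measurableTypeR R) R :=
  if v == 0 then (\d_(0 : measurableTypeR R) : probability (measurableTypeR R) R)
  else (normal_prob 0 (Num.sqrt v) : probability (measurableTypeR R) R).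

(* The distribution of X n under P n converges weakly to mu. *)
Definition cvg_in_law (d : measure_display) (T : measurableType d)
    (R : realType) (P : nat -> {measure set T -> \bar R}) (X : nat -> T -> R)
    (mu : probability (measurableTypeR R) R) : Prop :=
  forall f : R -> R, continuous f -> bounded_fun f ->
    (\int[P n]_t f (X n t))%R @[n --> \oo] --> (\int[mu]_x f x)%R.

(* Main.v *)
Require Import Defs.
From mathcomp Require Import all_boot all_order all_algebra.
From mathcomp Require Import all_classical all_reals all_analysis.
From mathcomp Require Import measurable_realfun ring lra zify.

(** Reading the digits of an integer from the left is reading a word accepted by
a finite automaton.  In state j a digit below [c j] leads back to state 1 and
the digit [c j] leads to state j + 1.  The values of the accepted words of
length n that start in state 1 fill [0, G_{n+1}) without repetition, so that
the integers with n + 1 digits are the automaton paths of length n + 1 with a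
nonzero first digit ([legal_decompositionE], [sum_nb_nonzero_leading]).  Hence a
sum over these integers of a function of the number of nonzero digits is a sum
over the paths of a matrix proportional to [P_LL].  The Doob transform turns
the sum over paths into an expectation for the Markov chain Q, multiplied by
[phi] at the first state and by its inverse at the last one
([value_sum_walk_op]).

The central limit theorem for this chain ([chain_clt]) is proved by comparing
two operators on functions.  Let a = 1 / sqrt (n + 1), and let one step of the
chain act on functions u (x, z) of the rescaled sum x and the state z.  For a
test function f, put u = f + a f' h1 + a^2 f'' h2, where h1 and h2 solve the
Poisson equations that remove the dependence on the state of the terms of order
1 and 2.  One step maps u to u + (a^2 sigma^2 / 2) f'' up to O(a^3), and so does
the replacement of f by its average over a centered Gaussian translation of
variance a^2 sigma^2.  Both operators are contractions, so after n steps they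
differ by O(n a^3), and the Gaussian averages compose to N(0, sigma^2) because
they form a semigroup ([heat_heat]).  The weight at the last state becomes a
constant because the chain mixes ([mixing]): every state reaches the state
which reads zeros forever.  The first Poisson equation is solved by
h1 = Qsharp gtilde - gtilde, and the solvability condition of the second one is
the formula for sigma^2.

The test functions are those with second-order Taylor estimates
([taylor2]), a class stable under averages of translations.  Superpositions of
cubic ramps belong to it and approximate continuous functions on bounded
intervals, hence convergence on this class is weak convergence
([weak_cvg_of_smooth]).  The law of large numbers is a consequence: smooth
functions that detect the outside of an interval have a small limit. *)

Set Implicit Arguments.
Unset Strict Implicit.
Unset Printing Implicit Defensive.

Import Order.TTheory GRing.Theory Num.Theory.
Import numFieldNormedType.Exports.

Local Open Scope classical_set_scope.
Local Open Scope ring_scope.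

(** * Test functions with second-order Taylor estimates *)

Section TaylorClass.
Context {R : realType}.
Implicit Types (K : R) (f : R -> R).

(** [f1] and [f2] stand for the first two derivatives of [f].  Requiring the
Taylor estimates instead of derivatives makes the class stable under averages
of translations, with the same constant. *)
Definition taylor2 K f f1 f2 :=
  [/\ forall x, [/\ `|f x| <= K, `|f1 x| <= K & `|f2 x| <= K],
      forall x y, `|f (x + y) - f x - y * f1 x - y ^+ 2 / 2 * f2 x| <= K * `|y| ^+ 3,
      forall x y, `|f1 (x + y) - f1 x - y * f2 x| <= K * y ^+ 2
    & forall x y, `|f2 (x + y) - f2 x| <= K * `|y|].

Definition smooth f := exists K f1 f2, taylor2 K f f1 f2.

Lemma taylor2_ge0 K f f1 f2 : taylor2 K f f1 f2 -> 0 <= K.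
Proof. by case=> /(_ 0)[+ _ _] _ _ _; apply: le_trans. Qed.

Lemma smooth_cst c : smooth (cst c).
Proof.
exists `|c|, (cst 0), (cst 0); split=> [x|x y|x y|x y] /=; rewrite ?normr0//.
- by rewrite subrr mulr0 mulr0 !subr0 normr0 mulr_ge0.
- by rewrite subrr mulr0 subr0 normr0 mulr_ge0 ?sqr_ge0.
- by rewrite subrr normr0 mulr_ge0.
Qed.

Lemma smoothD f g : smooth f -> smooth g -> smooth (fun x => f x + g x).
Proof.
move=> [K [f1 [f2 [b t0 t1 t2]]]] [K' [g1 [g2 [b' t0' t1' t2']]]].
exists (K + K'), (fun x => f1 x + g1 x), (fun x => f2 x + g2 x).
split=> [x|x y|x y|x y]; rewrite ?(mulrDl K).
- have [? ? ?] := b x; have [? ? ?] := b' x.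
  by split; apply: le_trans (ler_normD _ _) (lerD _ _).
- apply: le_trans (lerD (t0 x y) (t0' x y)); apply: le_trans (ler_normD _ _).
  by rewrite le_eqVlt; apply/orP; left; apply/eqP; congr `|_|; ring.
- apply: le_trans (lerD (t1 x y) (t1' x y)); apply: le_trans (ler_normD _ _).
  by rewrite le_eqVlt; apply/orP; left; apply/eqP; congr `|_|; ring.
- apply: le_trans (lerD (t2 x y) (t2' x y)); apply: le_trans (ler_normD _ _).
  by rewrite le_eqVlt; apply/orP; left; apply/eqP; congr `|_|; ring.
Qed.

Lemma smoothZ c f : smooth f -> smooth (fun x => c * f x).
Proof.
move=> [K [f1 [f2 [b t0 t1 t2]]]].
exists (`|c| * K), (fun x => c * f1 x), (fun x => c * f2 x).
split=> [x|x y|x y|x y]; rewrite -?(mulrA `|c|).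
- by have [? ? ?] := b x; split; rewrite normrM ler_wpM2l.
- apply: le_trans (ler_wpM2l (normr_ge0 c) (t0 x y)); rewrite -normrM.
  by rewrite le_eqVlt; apply/orP; left; apply/eqP; congr `|_|; ring.
- apply: le_trans (ler_wpM2l (normr_ge0 c) (t1 x y)); rewrite -normrM.
  by rewrite le_eqVlt; apply/orP; left; apply/eqP; congr `|_|; ring.
- apply: le_trans (ler_wpM2l (normr_ge0 c) (t2 x y)); rewrite -normrM.
  by rewrite le_eqVlt; apply/orP; left; apply/eqP; congr `|_|; ring.
Qed.

Lemma smooth_affine a b f : smooth f -> smooth (fun x => f (a * x + b)).
Proof.
move=> [K [f1 [f2 T]]]; have K0 := taylor2_ge0 T; have [bd t0 t1 t2] := T.
have a0 := normr_ge0 a.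
pose k := 1 + `|a| + `|a| ^+ 2 + `|a| ^+ 3.
have [k0 k1 k2 k3] : [/\ 1 <= k, `|a| <= k, `|a| ^+ 2 <= k & `|a| ^+ 3 <= k].
  by rewrite /k; split; have := exprn_ge0 2 a0; have := exprn_ge0 3 a0; lra.
have E (x y : R) : a * (x + y) + b = (a * x + b) + a * y by ring.
exists (k * K), (fun x => a * f1 (a * x + b)), (fun x => a ^+ 2 * f2 (a * x + b)).
split=> [x|x y|x y|x y]; rewrite ?E.
- have [? ? ?] := bd (a * x + b).
  rewrite normrM (normrM (a ^+ 2)) normrX; split; last 2 first.
  + by apply: ler_pM.
  + by apply: ler_pM => //; exact: exprn_ge0.
  + by apply: (le_trans (_ : _ <= K)) => //; rewrite ler_peMl.
- have := t0 (a * x + b) (a * y).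
  rewrite (_ : _ - _ - _ - _ = f (a * x + b + a * y) - f (a * x + b) -
    y * (a * f1 (a * x + b)) - y ^+ 2 / 2 * (a ^+ 2 * f2 (a * x + b))); last by ring.
  move=> /le_trans; apply; rewrite normrM exprMn mulrA mulrC (mulrC K).
  by rewrite [leRHS]mulrC ler_wpM2l ?exprn_ge0// ler_wpM2r.
- have := ler_wpM2l a0 (t1 (a * x + b) (a * y)).
  rewrite -normrM.
  rewrite (_ : a * (_ - _) = a * f1 (a * x + b + a * y) - a * f1 (a * x + b) -
    y * (a ^+ 2 * f2 (a * x + b))); last by ring.
  move=> /le_trans; apply.
  rewrite exprMn -(real_normK (num_real a)).
  rewrite (_ : `|a| * _ = (`|a| ^+ 3) * (K * y ^+ 2)); last by ring.
  by rewrite -[leRHS]mulrA ler_wpM2r// mulr_ge0// sqr_ge0.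
- have := ler_wpM2l (exprn_ge0 2 a0) (t2 (a * x + b) (a * y)).
  rewrite -normrX -normrM mulrBr => /le_trans; apply.
  rewrite (normrM a y) normrX (_ : `|a| ^+ 2 * (K * (`|a| * `|y|)) = (`|a| ^+ 3) * (K * `|y|));
    last by ring.
  by rewrite -[leRHS]mulrA ler_wpM2r// mulr_ge0.
Qed.

Lemma lipschitz1_continuous (h : R -> R) C : 0 <= C ->
  (forall x y, `|y| <= 1 -> `|h (x + y) - h x| <= C * `|y|) -> continuous h.
Proof.
move=> C0 hL x; apply/cvgrPdist_le => e e0.
have d0 : 0 < Num.min 1 (e / (C + 1)).
  by rewrite lt_min ltr01 divr_gt0//; lra.
near=> y.
have : ball x (Num.min 1 (e / (C + 1))) y by near: y; exact: (near_ball x _ d0).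
rewrite /ball /= distrC lt_min => /andP[/ltW y1 +].
rewrite ltr_pdivlMr; last by lra.
have := hL x (y - x) y1; rewrite (addrC x) subrK (distrC (h y)).
by have := normr_ge0 (y - x); lra.
Unshelve. all: by end_near. Qed.

Lemma taylor2_lipschitz K f f1 f2 : taylor2 K f f1 f2 ->
  forall x y, `|y| <= 1 -> `|f (x + y) - f x| <= 3 * K * `|y|.
Proof.
move=> T; have K0 := taylor2_ge0 T; have [bd t0 _ _] := T => x y y1.
have [_ b1 b2] := bd x.
rewrite (_ : f (x + y) - f x = (f (x + y) - f x - y * f1 x - y ^+ 2 / 2 * f2 x) +
   (y * f1 x + y ^+ 2 / 2 * f2 x)); last by ring.
have y0 := normr_ge0 y.
have y2 : `|y| ^+ 2 <= `|y| by rewrite expr2 ler_piMl.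
have y3 : `|y| ^+ 3 <= `|y| by rewrite exprS ler_piMr ?exprn_ile1.
apply: le_trans (ler_normD _ _) _.
apply: (@le_trans _ _ (K * `|y| + (K * `|y| + K * `|y|))); last lra.
apply: lerD; first by apply: le_trans (t0 x y) _; rewrite ler_wpM2l.
apply: le_trans (ler_normD _ _) _; apply: lerD.
  by rewrite normrM mulrC ler_wpM2r.
rewrite normrM mulrC; apply: ler_pM => //.
by rewrite normrM normrX (ger0_norm (_ : 0 <= 2^-1))//; lra.
Qed.

Lemma taylor2_continuous K f f1 f2 : taylor2 K f f1 f2 ->
  [/\ continuous f, continuous f1 & continuous f2].
Proof.
move=> T; have K0 := taylor2_ge0 T; have [b t0 t1 t2] := T; split.
- apply: (@lipschitz1_continuous _ (3 * K)); first lra.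
  exact: (taylor2_lipschitz T).
- apply: (@lipschitz1_continuous _ (2 * K)) => [|x y y1]; first lra.
  have [_ _ b2] := b x.
  rewrite (_ : _ - _ = (f1 (x + y) - f1 x - y * f2 x) + y * f2 x); last by ring.
  apply: le_trans (ler_normD _ _) _.
  rewrite (_ : 2 * K * _ = K * `|y| + K * `|y|); last by ring.
  apply: lerD.
    apply: le_trans (t1 x y) _; rewrite ler_wpM2l// -(real_normK (num_real _)) expr2.
    by rewrite ler_piMl.
  by rewrite normrM mulrC ler_wpM2r.
- exact: (@lipschitz1_continuous _ K).
Qed.

Definition pos_part (x : R) := Num.max x 0.

Lemma pos_partP x : (0 <= x /\ pos_part x = x) \/ (x <= 0 /\ pos_part x = 0).
Proof.
rewrite /pos_part; case: (leP 0 x) => [x0|/ltW x0]; [left|right]; split=> //.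
Qed.

(** The integral of the quadratic B-spline with knots 0, 1, 2, 3: a C^2 passage
from 0 to 1 whose second derivative is Lipschitz. *)
Definition cubic_ramp (x : R) :=
  (pos_part x ^+ 3 - 3 * pos_part (x - 1) ^+ 3 + 3 * pos_part (x - 2) ^+ 3
   - pos_part (x - 3) ^+ 3) / 6.

Lemma cubic_ramp_le0 x : x <= 0 -> cubic_ramp x = 0.
Proof. by move=> x0; rewrite /cubic_ramp /pos_part !max_r; lra. Qed.

Lemma cubic_ramp_ge3 x : 3 <= x -> cubic_ramp x = 1.
Proof. by move=> x3; rewrite /cubic_ramp /pos_part !max_l; lra. Qed.

(** On [0, 1] the ramp is x^3 / 6, on [2, 3] it is symmetric to that, and the
middle piece is bounded through (1 - t)^2 (1 + 2 t) >= 0. *)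
Lemma cubic_ramp_01 x : 0 <= cubic_ramp x <= 1.
Proof.
have [/cubic_ramp_le0->|x0] := leP x 0; first lra.
have [/cubic_ramp_ge3->|x3] := leP 3 x; first lra.
have [x1|x1] := leP x 1.
  rewrite (_ : cubic_ramp x = x ^+ 3 / 6); last by rewrite /cubic_ramp /pos_part max_l ?max_r; lra.
  have := exprn_ge0 3 (ltW x0); have := exprn_ile1 3 (ltW x0) x1; lra.
have [x2|x2] := leP x 2.
  rewrite (_ : cubic_ramp x = (x ^+ 3 - 3 * (x - 1) ^+ 3) / 6); last first.
    by rewrite /cubic_ramp /pos_part max_l ?(max_l (_ : 0 <= x - 1)) ?max_r; lra.
  pose t := x - 1; have [t0 t1] : 0 <= t /\ t <= 1 by rewrite /t; lra.
  have := exprn_ge0 3 t0; have := exprn_ile1 3 t0 t1; have := exprn_ge0 2 t0.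
  have := exprn_ile1 2 t0 t1.
  have -> : x = 1 + t by rewrite /t; ring.
  have -> : 1 + t - 1 = t by ring.
  have -> : (1 + t) ^+ 3 = 1 + 3 * t + 3 * t ^+ 2 + t ^+ 3 by ring.
  have : t ^+ 3 <= t ^+ 2 by rewrite exprS ler_piMl ?exprn_ge0.
  have : 0 <= (1 - t) ^+ 2 * (1 + 2 * t) by rewrite mulr_ge0 ?sqr_ge0//; lra.
  have -> : (1 - t) ^+ 2 * (1 + 2 * t) = 1 - 3 * t ^+ 2 + 2 * t ^+ 3 by ring.
  lra.
rewrite (_ : cubic_ramp x = 1 - (3 - x) ^+ 3 / 6); last first.
  by rewrite /cubic_ramp /pos_part max_l ?(max_l (_ : 0 <= x - 1)) ?(max_l (_ : 0 <= x - 2))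
    ?max_r; lra.
have h0 : 0 <= 3 - x by lra.
have h1 : 3 - x <= 1 by lra.
have := exprn_ge0 3 h0; have := exprn_ile1 3 h0 h1; lra.
Qed.

(** When x and x + y have the same sign the remainders are those of the cube or
of zero; otherwise y is, up to sign, the sum of the distances of x and x + y to
0, which bounds every term. *)
Lemma pos_part_taylor x y :
  [/\ `|pos_part (x + y) ^+ 3 - pos_part x ^+ 3 - y * (3 * pos_part x ^+ 2)
        - y ^+ 2 / 2 * (6 * pos_part x)| <= `|y| ^+ 3,
     `|3 * pos_part (x + y) ^+ 2 - 3 * pos_part x ^+ 2 - y * (6 * pos_part x)| <= 3 * y ^+ 2
   & `|6 * pos_part (x + y) - 6 * pos_part x| <= 6 * `|y|].
Proof.
rewrite -normrX !ler_norml.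
case: (pos_partP x) => [] [hx ->]; case: (pos_partP (x + y)) => [] [hy ->].
- split.
  + by have := ler_norm (y ^+ 3); have := ler_norm (- (y ^+ 3)); rewrite normrN;
      rewrite !exprS !expr0; lra.
  + by rewrite !exprS !expr0; apply/andP; split; nra.
  + by have := ler_norm y; have := ler_norm (- y); rewrite normrN; lra.
- have [u u0 ->] : exists2 u, 0 <= u & y = - (x + u) by exists (- (x + y)); [lra|ring].
  have := mulr_ge0 (exprn_ge0 2 hx) u0; have := mulr_ge0 hx (exprn_ge0 2 u0).
  have := exprn_ge0 3 u0; have := exprn_ge0 3 hx; have := mulr_ge0 hx u0.
  have := exprn_ge0 2 u0; have := exprn_ge0 2 hx.
  by rewrite normrX normrN ger0_norm ?addr_ge0// => *; split; lra.
- have [v [p [v0 p0 -> ->]]] : exists v p, [/\ 0 <= v, 0 <= p, y = v + p & x = - p].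
    by exists (x + y), (- x); split; [lra|lra|ring|ring].
  have := mulr_ge0 (exprn_ge0 2 v0) p0; have := mulr_ge0 v0 (exprn_ge0 2 p0).
  have := exprn_ge0 3 v0; have := exprn_ge0 3 p0; have := mulr_ge0 v0 p0.
  have := exprn_ge0 2 v0; have := exprn_ge0 2 p0.
  by rewrite normrX ger0_norm ?addr_ge0// => *; split; lra.
- have := normr_ge0 (y ^+ 3); have := normr_ge0 y; have := sqr_ge0 y.
  by move=> *; split; lra.
Qed.

Lemma third_diff_le (a0 a1 a2 a3 b : R) :
  `|a0| <= b -> `|a1| <= b -> `|a2| <= b -> `|a3| <= b ->
  `|(a0 - 3 * a1 + 3 * a2 - a3) / 6| <= 2 * b.
Proof. by rewrite !ler_norml; lra. Qed.

Lemma smooth_cubic_ramp : smooth cubic_ramp.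
Proof.
pose f1 x := (3 * pos_part x ^+ 2 - 3 * (3 * pos_part (x - 1) ^+ 2)
  + 3 * (3 * pos_part (x - 2) ^+ 2) - 3 * pos_part (x - 3) ^+ 2) / 6.
pose f2 x := (6 * pos_part x - 3 * (6 * pos_part (x - 1))
  + 3 * (6 * pos_part (x - 2)) - 6 * pos_part (x - 3)) / 6.
have E (x y k : R) : x + y - k = (x - k) + y by ring.
exists 12, f1, f2; split=> [x|x y|x y|x y].
- split.
  + by have := cubic_ramp_01 x; rewrite ler_norml; lra.
  + rewrite /f1; case: (pos_partP x) => [] [h0 ->];
    case: (pos_partP (x - 1)) => [] [h1 ->];
    case: (pos_partP (x - 2)) => [] [h2 ->];
    case: (pos_partP (x - 3)) => [] [h3 ->]; try lra;
    rewrite ler_norml !exprS !expr0; apply/andP; split; nra.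
  + rewrite /f2; case: (pos_partP x) => [] [h0 ->];
    case: (pos_partP (x - 1)) => [] [h1 ->];
    case: (pos_partP (x - 2)) => [] [h2 ->];
    case: (pos_partP (x - 3)) => [] [h3 ->]; try lra;
    rewrite ler_norml; apply/andP; split; lra.
- have [+ _ _] := pos_part_taylor x y; have [+ _ _] := pos_part_taylor (x - 1) y.
  have [+ _ _] := pos_part_taylor (x - 2) y; have [+ _ _] := pos_part_taylor (x - 3) y.
  move=> l3 l2 l1 l0; have D := third_diff_le l0 l1 l2 l3.
  apply: (le_trans _ (le_trans D _)); last first.
    by have := normr_ge0 y; have := exprn_ge0 3 (normr_ge0 y); have := sqr_ge0 y; lra.
  rewrite /cubic_ramp /f1 /f2 !(E x y) le_eqVlt; apply/orP; left; apply/eqP; congr `|_|.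
  move: (pos_part (x + y)) (pos_part (x - 1 + y)) (pos_part (x - 2 + y)) (pos_part (x - 3 + y)).
  move: (pos_part x) (pos_part (x - 1)) (pos_part (x - 2)) (pos_part (x - 3)) => *.
  by field.
- have [_ + _] := pos_part_taylor x y; have [_ + _] := pos_part_taylor (x - 1) y.
  have [_ + _] := pos_part_taylor (x - 2) y; have [_ + _] := pos_part_taylor (x - 3) y.
  move=> l3 l2 l1 l0; have D := third_diff_le l0 l1 l2 l3.
  apply: (le_trans _ (le_trans D _)); last first.
    by have := normr_ge0 y; have := exprn_ge0 3 (normr_ge0 y); have := sqr_ge0 y; lra.
  rewrite /f1 /f2 !(E x y) le_eqVlt; apply/orP; left; apply/eqP; congr `|_|.
  move: (pos_part (x + y)) (pos_part (x - 1 + y)) (pos_part (x - 2 + y)) (pos_part (x - 3 + y)).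
  move: (pos_part x) (pos_part (x - 1)) (pos_part (x - 2)) (pos_part (x - 3)) => *.
  by field.
- have [_ _ +] := pos_part_taylor x y; have [_ _ +] := pos_part_taylor (x - 1) y.
  have [_ _ +] := pos_part_taylor (x - 2) y; have [_ _ +] := pos_part_taylor (x - 3) y.
  move=> l3 l2 l1 l0; have D := third_diff_le l0 l1 l2 l3.
  apply: (le_trans _ (le_trans D _)); last first.
    by have := normr_ge0 y; have := exprn_ge0 3 (normr_ge0 y); have := sqr_ge0 y; lra.
  rewrite /f2 !(E x y) le_eqVlt; apply/orP; left; apply/eqP; congr `|_|.
  move: (pos_part (x + y)) (pos_part (x - 1 + y)) (pos_part (x - 2 + y)) (pos_part (x - 3 + y)).
  move: (pos_part x) (pos_part (x - 1)) (pos_part (x - 2)) (pos_part (x - 3)) => *.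
  by field.
Qed.

(** The modulus is uniform in [x] because a compact set is a near-covering;
[y] is not restricted to the segment. *)
Lemma heine_cantor f (a b e : R) : continuous f -> 0 < e ->
  exists2 d, 0 < d & forall x y, a <= x <= b -> `|x - y| <= d -> `|f x - f y| <= e.
Proof.
move=> cf e0.
pose P (d x : R) := forall y, `|x - y| <= d -> `|f x - f y| <= e.
have covP : \forall d \near (0 : R)^'+, `[a, b]%classic `<=` P d.
  have /compact_near_coveringP Pab := @segment_compact R a b.
  apply: Pab => x _.
  have e2 : 0 < e / 2 by lra.
  have /cvgrPdist_le/(_ _ e2) := cf x.
  move=> /nbhs_ballP[d /= d0 xd].
  have d2 : 0 < d / 2 by lra.
  near=> x' d' => y /= x'y.
  have x'x : ball x (d / 2) x' by near: x'; exact: (near_ball x _ d2).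
  have d'd : d' < d / 2 by near: d'; apply: nbhs_right_lt; lra.
  have h1 : `|f x - f x'| <= e / 2.
    by apply: xd; apply: le_ball x'x; lra.
  have h2 : `|f x - f y| <= e / 2.
    apply: xd; move: x'x; rewrite /ball /=.
    have := ler_normD (x - x') (x' - y); rewrite addrA subrK; lra.
  rewrite (_ : f x' - f y = - (f x - f x') + (f x - f y)); last by ring.
  by apply: le_trans (ler_normD _ _) _; rewrite normrN; lra.
near (0 : R)^'+ => d; exists d; first by near: d; exact: nbhs_right_gt.
move=> x y abx; have : `[a, b]%classic `<=` P d by near: d.
by move=> /(_ x) dP; apply: dP; rewrite /= in_itv.
Unshelve. all: by end_near. Qed.

(** One ramp for each cell of the grid, of height the increment of [f] over
the cell; the factor 3 / h stretches the ramp to the width of the cell. *)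
Fixpoint staircase f (a h : R) (N : nat) (x : R) : R :=
  if N is k.+1 then staircase f a h k x +
    (f (a + k.+1%:R * h) - f (a + k%:R * h)) * cubic_ramp (3 / h * x - 3 / h * (a + k%:R * h))
  else f a.

Lemma smooth_staircase f a h N : smooth (staircase f a h N).
Proof.
elim: N => [|k IH] /=; first exact: smooth_cst.
by apply: smoothD => //; apply: smoothZ; apply: smooth_affine; exact: smooth_cubic_ramp.
Qed.

Lemma staircase_right f (a h : R) N x : 0 < h -> a + N%:R * h <= x ->
  staircase f a h N x = f (a + N%:R * h).
Proof.
move=> h0; elim: N x => [|k IH] x /= hx; first by rewrite mul0r addr0.
rewrite IH; last by move: hx; rewrite -natr1 mulrDl mul1r; lra.
rewrite cubic_ramp_ge3 ?mulr1 ?subrKC//.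
rewrite -mulrBr mulrAC ler_pdivlMr// ler_wpM2l//.
by move: hx; rewrite -natr1 mulrDl mul1r; lra.
Qed.

(** To the left of the last cell the last ramp has not started; on the last cell
the previous ones are complete, and the value interpolates between two values
of [f]. *)
Lemma staircaseS f (a h : R) k x : 0 < h ->
  (x <= a + k%:R * h /\ staircase f a h k.+1 x = staircase f a h k x) \/
  (a + k%:R * h <= x /\ exists2 t, 0 <= t <= 1 & staircase f a h k.+1 x =
     (1 - t) * f (a + k%:R * h) + t * f (a + k.+1%:R * h)).
Proof.
move=> h0; have [xk|xk] := leP x (a + k%:R * h); [left|right].
  split=> //=; rewrite cubic_ramp_le0 ?mulr0 ?addr0//.
  by rewrite -mulrBr pmulr_rle0 ?divr_gt0// subr_le0.
split; first exact: ltW.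
exists (cubic_ramp (3 / h * x - 3 / h * (a + k%:R * h))); first exact: cubic_ramp_01.
by rewrite [LHS]/= staircase_right ?(ltW xk)//; ring.
Qed.

Lemma staircase_bound f (a h M : R) N x : 0 < h -> (forall y, `|f y| <= M) ->
  `|staircase f a h N x| <= M.
Proof.
move=> h0 fM; elim: N x => [|k IH] x; first exact: fM.
have [[_ ->//]|[_ [t /andP[t0 t1] ->]]] := staircaseS f a k x h0.
apply: le_trans (ler_normD _ _) _; rewrite !normrM (ger0_norm t0) ger0_norm; last lra.
have := ler_wpM2l t0 (fM (a + k.+1%:R * h)).
have t'0 : 0 <= 1 - t by lra.
have := ler_wpM2l t'0 (fM (a + k%:R * h)); lra.
Qed.

Lemma staircase_near f (a h e : R) N x : 0 < h ->
  (forall u v, a <= u <= a + N%:R * h -> `|u - v| <= h -> `|f u - f v| <= e) ->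
  a <= x <= a + N%:R * h -> `|staircase f a h N x - f x| <= e.
Proof.
move=> h0; elim: N x => [|k IH] x fe /andP[ax xN].
  rewrite distrC; apply: fe; first by rewrite ax.
  by rewrite mul0r addr0 in xN; rewrite ger0_norm; lra.
have kS : a + k.+1%:R * h = a + k%:R * h + h by rewrite -natr1; ring.
have kh : 0 <= k%:R * h by rewrite mulr_ge0// ltW.
have [[xk ->]|[xk [t /andP[t0 t1] ->]]] := staircaseS f a k x h0.
  by apply: IH; [move=> u v uk; apply: fe; lra | lra].
have t'0 : 0 <= 1 - t by lra.
have e1 : `|f x - f (a + k%:R * h)| <= e.
  by apply: fe; [lra | rewrite ger0_norm; lra].
have e2 : `|f x - f (a + k.+1%:R * h)| <= e.
  by apply: fe; [lra | rewrite ler0_norm; lra].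
have := ler_wpM2l t0 e2; have := ler_wpM2l t'0 e1.
move=> h1 h2; rewrite distrC (_ : f x - _ = (1 - t) * (f x - f (a + k%:R * h)) +
   t * (f x - f (a + k.+1%:R * h))); last by ring.
apply: le_trans (ler_normD _ _) _.
by rewrite !normrM (ger0_norm t0) (ger0_norm t'0); lra.
Qed.

(** A grid finer than the modulus of continuity of [f]; being an interpolation,
the staircase does not exceed the bound on [f] outside the interval either. *)
Lemma smooth_approx f (A e M : R) : continuous f -> (forall x, `|f x| <= M) ->
  0 < e -> 0 <= A -> exists s, [/\ smooth s, forall x, `|s x| <= M
    & forall x, `|x| <= A -> `|s x - f x| <= e].
Proof.
move=> cf fM e0 A0.
have [h0 h00 hP] := @heine_cantor f (- A) (A + 1) e cf e0.
pose h := Num.min h0 1; have hgt0 : 0 < h by rewrite lt_min h00 ltr01.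
pose N := Num.truncn (2 * A / h).
have /andP[N1 N2] : N%:R <= 2 * A / h < N.+1%:R.
  by apply: Num.Theory.truncn_itv; rewrite divr_ge0 ?mulr_ge0// ltW.
rewrite ler_pdivlMr// in N1; rewrite ltr_pdivrMr// in N2.
have h1 : h <= 1 by rewrite ge_min lexx orbT.
exists (staircase f (- A) h N.+1); split.
- exact: smooth_staircase.
- by move=> x; apply: staircase_bound.
- move=> x; rewrite ler_norml => xA; apply: staircase_near => //; last lra.
  move=> u v uA uv; apply: hP; last by apply: le_trans uv _; rewrite ge_min lexx.
  by move: uA; rewrite -natr1 mulrDl mul1r; lra.
Qed.
End TaylorClass.

(** * Weak convergence from test functions *)

Section WeakConvergence.
Context {R : realType}.
Implicit Types (f : R -> R).

Definition sample_mean (K : nat) (X : nat -> R) f : R := K%:R^-1 * \sum_(i < K) f (X i).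

Lemma sample_mean_dist K X f g h : (0 < K)%N -> (forall x, `|f x - g x| <= h x) ->
  `|sample_mean K X f - sample_mean K X g| <= sample_mean K X h.
Proof.
move=> K0 fg; rewrite /sample_mean -mulrBr -sumrB normrM gtr0_norm ?invr_gt0 ?ltr0n//.
rewrite ler_wpM2l ?invr_ge0//; apply: le_trans (ler_norm_sum _ _ _) _.
by apply: ler_sum => i _.
Qed.

Section Prob.
Variable mu : probability (measurableTypeR R) R.

Lemma integrable_bounded f M : continuous f -> (forall x, `|f x| <= M) ->
  mu.-integrable [set: R] (EFin \o f).
Proof.
move=> cf fM; apply: (@le_integrable _ _ _ mu _ measurableT _ (EFin \o cst M)).
- by apply/measurable_EFinP; exact: continuous_measurable_fun.
- move=> x _ /=; rewrite lee_fin (le_trans (fM x))//; exact: ler_norm.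
- exact: finite_measure_integrable_cst.
Qed.

Lemma Rintegral_dist f g h : mu.-integrable [set: R] (EFin \o f) ->
  mu.-integrable [set: R] (EFin \o g) -> mu.-integrable [set: R] (EFin \o h) ->
  (forall x, `|f x - g x| <= h x) ->
  `|\int[mu]_x f x - \int[mu]_x g x| <= \int[mu]_x h x.
Proof.
move=> If Ig Ih fg; rewrite -RintegralB//.
have Ifg : mu.-integrable [set: R] (EFin \o (fun x => f x - g x)).
  exact: (integrableB measurableT If Ig).
apply: le_trans (le_normr_Rintegral measurableT Ifg) _.
apply: le_Rintegral => //=; exact: (integrable_norm Ifg).
Qed.

Lemma Rintegral_cst_prob (c : R) : \int[mu]_x c = c.
Proof. by rewrite Rintegral_cst//= probability_setT/= mulr1. Qed.

(** A smooth function which detects that x is far from 0: it vanishes on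
[-A, A] and is at least 1 outside [-A - 3, A + 3]. *)
Definition tail_test (A x : R) := cubic_ramp (1 * x + - A) + cubic_ramp ((-1) * x + - A).

Lemma smooth_tail_test A : smooth (tail_test A).
Proof. by apply: smoothD; apply: smooth_affine; exact: smooth_cubic_ramp. Qed.

Lemma tail_test_ge0 A x : 0 <= tail_test A x.
Proof. by rewrite addr_ge0//; have /andP[] := @cubic_ramp_01 R (1 * x - A);
  have /andP[] := @cubic_ramp_01 R (-1 * x - A). Qed.

Lemma tail_test_le2 A x : tail_test A x <= 2.
Proof. by have /andP[_ ] := @cubic_ramp_01 R (1 * x - A);
  have /andP[_ ] := @cubic_ramp_01 R (-1 * x - A); rewrite /tail_test; lra. Qed.

Lemma tail_test_in A x : `|x| <= A -> tail_test A x = 0.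
Proof. by rewrite ler_norml => xA; rewrite /tail_test !cubic_ramp_le0 ?addr0//; lra. Qed.

Lemma tail_test_out A x : A + 3 <= `|x| -> 1 <= tail_test A x.
Proof.
move=> Ax; have /andP[? _] := @cubic_ramp_01 R (1 * x - A).
have /andP[? _] := @cubic_ramp_01 R (-1 * x - A).
rewrite /tail_test; have [x0|x0] := leP 0 x.
  by rewrite ger0_norm// in Ax; rewrite cubic_ramp_ge3; lra.
by rewrite ltr0_norm// in Ax; rewrite (@cubic_ramp_ge3 _ (-1 * x - A)); lra.
Qed.

(** The test for [-n, n] is at most 2 and vanishes there, and the sets |x| > n
decrease to the empty set. *)
Lemma tail_small e : 0 < e -> exists2 A, 0 <= A & \int[mu]_x tail_test A x <= e.
Proof.
move=> e0.
pose F (n : nat) := [set x : R | n%:R < `|x|].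
have mF n : measurable (F n).
  have -> : F n = [set: R] `&` (fun x : R => `|x|) @^-1` `]n%:R, +oo[%classic.
    by apply/seteqP; split=> x; rewrite /F /= in_itv/= andbT; tauto.
  have mn : measurable_fun [set: R] (@Num.Def.normr _ R).
    by apply: continuous_measurable_fun; exact: norm_continuous.
  exact: mn.
have capF : \bigcap_n F n = set0.
  apply/seteqP; split=> // x /(_ (Num.truncn `|x|).+1 I).
  by rewrite /F/= ltNge (ltW (truncnS_gt _)).
have : mu (F n) @[n --> \oo] --> mu set0.
  rewrite -capF.
  apply: nonincreasing_cvg_mu => //.
  - by apply: (@le_lt_trans _ _ 1%E); [exact: (probability_le1 mu (mF 0%N))|exact: ltry].
  - by rewrite capF; exact: measurable0.
  - move=> m n mn; apply/subsetPset => x; rewrite /F /=.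
    by apply: le_lt_trans; rewrite ler_nat.
rewrite measure0 => /fine_cvgP[_] /cvgr0Pnorm_le /(_ (e / 2)).
have e2 : 0 < e / 2 by lra.
move=> /(_ e2)[N _ /(_ N (leqnn N))] /= muN.
exists N%:R => //.
have Ind : mu.-integrable [set: R] (EFin \o \1_(F N)).
  apply: (@le_integrable _ _ _ mu _ measurableT _ (EFin \o cst 1)).
  - apply/measurable_EFinP.
    by apply: (@measurable_indic _ (measurableTypeR R) R setT (F N)); exact: mF.
  - by move=> x _ /=; rewrite lee_fin indicE normr1; case: (x \in F N); rewrite ?normr1 ?normr0.
  - exact: finite_measure_integrable_cst.
have cT := taylor2_continuous.
have [K [f1 [f2 /cT[ct _ _]]]] := smooth_tail_test N%:R.
have It : mu.-integrable [set: R] (EFin \o tail_test N%:R).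
  apply: (@integrable_bounded _ 2) => // x.
  by rewrite ger0_norm ?tail_test_ge0 ?tail_test_le2.
apply: (@le_trans _ _ (\int[mu]_x (2 * \1_(F N) x))).
  apply: le_Rintegral => //.
    exact: (integrableZl measurableT 2 Ind).
  move=> x _; rewrite indicE; have [/set_mem xF|xF] := boolP (x \in F N).
    by rewrite mulr1 tail_test_le2.
  rewrite mulr0 tail_test_in// leNgt; apply: contra xF => xF.
  exact: mem_set.
rewrite RintegralZl// /Rintegral.
rewrite (@integral_indic _ (measurableTypeR R) _ mu setT _ (F N)) ?setIT;
  [|exact: measurableT|exact: mF].
by move: muN; have := ler_norm (fine (mu (F N))); lra.
Qed.

(** On a large interval [f] is within e / 8 of a staircase, and outside it both
are bounded by M.  The mass out there is bounded by testing with [tail_test],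
itself smooth, so that tightness of the samples follows from the convergence on
smooth functions. *)
Lemma weak_cvg_of_smooth (K : nat -> nat) (X : nat -> nat -> R) :
  (forall n, (0 < K n)%N) ->
  (forall f, smooth f -> sample_mean (K n) (X n) f @[n --> \oo] --> \int[mu]_x f x) ->
  forall f, continuous f -> bounded_fun f ->
    sample_mean (K n) (X n) f @[n --> \oo] --> \int[mu]_x f x.
Proof.
move=> K0 cvs f cf bf.
have [M M0 fM] : exists2 M : R, 0 < M & forall x, `|f x| <= M.
  have [M0 [_ bM]] := bf.
  exists (Num.max M0 0 + 1); first by rewrite ltr_wpDl// le_max lexx orbT.
  by move=> x; apply: bM => //; rewrite ltr_pwDr// le_max lexx.
apply/cvgrPdist_le => e e0.
have [A A0 tA] := @tail_small (e / (20 * M)) (divr_gt0 e0 (mulr_gt0 (ltr0Sn R 19) M0)).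
have e8 : 0 < e / 8 by lra.
have A3 : 0 <= A + 3 by lra.
have [s [ss sM sA]] := smooth_approx cf fM e8 A3.
have ct g : smooth g -> continuous g.
  by move=> [? [? [? /taylor2_continuous[]]]].
have If : mu.-integrable [set: R] (EFin \o f) by exact: integrable_bounded fM.
have Is : mu.-integrable [set: R] (EFin \o s).
  by apply: integrable_bounded sM; exact: ct.
have sh : smooth (fun x => e / 8 + 2 * M * tail_test A x).
  by apply: smoothD; [exact: smooth_cst|apply: smoothZ; exact: smooth_tail_test].
have It : mu.-integrable [set: R] (EFin \o tail_test A).
  apply: (@integrable_bounded _ 2) => [|x]; first exact/ct/smooth_tail_test.
  by rewrite ger0_norm ?tail_test_ge0 ?tail_test_le2.
have Ic : mu.-integrable [set: R] (EFin \o cst (e / 8)).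
  exact: finite_measure_integrable_cst.
have ItM := integrableZl measurableT (2 * M) It.
have Ih : mu.-integrable [set: R] (EFin \o (fun x => e / 8 + 2 * M * tail_test A x)).
  exact: (integrableD measurableT Ic ItM).
have fs x : `|f x - s x| <= e / 8 + 2 * M * tail_test A x.
  have [xA|/ltW xA] := leP `|x| (A + 3).
    by rewrite distrC; apply: le_trans (sA x xA) _;
      rewrite lerDl mulr_ge0 ?tail_test_ge0// mulr_ge0// ltW.
  have := tail_test_out xA; rewrite -(ler_pM2l (mulr_gt0 (ltr0Sn R 1) M0)) mulr1.
  have := ler_normB (f x) (s x); have := fM x; have := sM x; lra.
have Jh : \int[mu]_x (e / 8 + 2 * M * tail_test A x) <= e / 4.
  have -> : \int[mu]_x (e / 8 + 2 * M * tail_test A x) =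
      \int[mu]_x (e / 8) + \int[mu]_x (2 * M * tail_test A x).
    exact: (RintegralD measurableT Ic ItM).
  have -> : \int[mu]_x (2 * M * tail_test A x) = 2 * M * \int[mu]_x tail_test A x.
    exact: (RintegralZl _ measurableT It).
  rewrite Rintegral_cst_prob.
  have : \int[mu]_x tail_test A x * (20 * M) <= e by rewrite -ler_pdivlMr// mulr_gt0.
  by lra.
have J1 := Rintegral_dist If Is Ih fs.
have /cvgrPdist_le/(_ _ e8) cv1 := cvs _ ss.
have /cvgrPdist_le/(_ _ e8) cv2 := cvs _ sh.
near=> n.
have h1 : `|\int[mu]_x s x - sample_mean (K n) (X n) s| <= e / 8 by near: n.
have h2 : `|\int[mu]_x (e / 8 + 2 * M * tail_test A x) -
  sample_mean (K n) (X n) (fun x => e / 8 + 2 * M * tail_test A x)| <= e / 8 by near: n.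
have h3 := sample_mean_dist (X n) (K0 n) fs.
have := ler_norm (sample_mean (K n) (X n) (fun x => e / 8 + 2 * M * tail_test A x)
  - \int[mu]_x (e / 8 + 2 * M * tail_test A x)).
rewrite distrC => h4.
rewrite (_ : _ - _ = (\int[mu]_x f x - \int[mu]_x s x) +
  (\int[mu]_x s x - sample_mean (K n) (X n) s) -
  (sample_mean (K n) (X n) f - sample_mean (K n) (X n) s));
  last by ring.
apply: le_trans (ler_normB _ _) _.
have := ler_normD (\int[mu]_x f x - \int[mu]_x s x)
  (\int[mu]_x s x - sample_mean (K n) (X n) s).
lra.
Unshelve. all: by end_near. Qed.
End Prob.
End WeakConvergence.

(** * Moments of the Gaussian law *)

Section Gaussian.
Context {R : realType}.
Implicit Types (f : R -> R).
Local Notation mu := (@lebesgue_measure R).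
Local Notation bell := (normal_fun (0 : R) 1).

(** The normal density is a version of the Radon-Nikodym derivative. *)
Lemma ge0_integral_normal_prob (m s : R) (h : R -> R) : measurable_fun [set: R] h ->
  (forall x, 0 <= h x) ->
  (\int[normal_prob m s]_x (h x)%:E = \int[mu]_x (h x * normal_pdf m s x)%:E)%E.
Proof.
move=> mh h0; have dom := @normal_prob_dominates R m s.
pose P : probability (measurableTypeR R) R := normal_prob m s.
have mhE : measurable_fun [set: R] (EFin \o h) by exact/measurable_EFinP.
have mp : measurable_fun [set: R] (fun x => (normal_pdf m s x)%:E).
  by apply/measurable_EFinP; exact: measurable_normal_pdf.
have RN0 := Radon_Nikodym_SigmaFinite.f_ge0 (nu := P) dom.
have RNi := Radon_Nikodym_SigmaFinite.f_integrable (nu := P) dom.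
rewrite -(Radon_Nikodym_SigmaFinite.change_of_variables (nu := P) dom _ measurableT mhE);
  last by move=> x; rewrite lee_fin.
under [RHS]eq_integral do rewrite EFinM.
apply: ae_eq_integral => //.
- by apply: emeasurable_funM => //; exact: (measurable_int mu RNi).
- exact: emeasurable_funM.
apply: ae_eqe_mul2l => /=.
apply: integral_ae_eq => //.
move=> E _ mE.
by rewrite -(Radon_Nikodym_SigmaFinite.f_integral (nu := P) dom).
Qed.

Lemma ge0_integral_affine (G : R -> R) (a b : R) : 0 < a -> continuous G ->
  (forall x, 0 <= G x) ->
  (\int[mu]_x (G x)%:E = \int[mu]_x (a * G (a * x + b))%:E)%E.
Proof.
move=> a0 cG G0; pose F (x : R) := a * x + b.
have dF x : is_derive (x : R) (1 : R) F a.
  by rewrite /F; apply: is_derive_eq; rewrite /GRing.scale/=; ring.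
have F'E : F^`()%classic = cst a.
  by apply/funext => x; rewrite derive1E derive_val.
rewrite (@increasing_ge0_integration_by_substitutionT R F G) //.
- apply: eq_integral => x _; rewrite F'E/=; congr EFin; rewrite /F fctE /=; ring.
- by move=> x y xy; rewrite /F ltrD2r ltr_pM2l.
- by rewrite F'E => x; exact: cvg_cst.
- by rewrite F'E; exact: is_cvg_cst.
- by rewrite F'E; exact: is_cvg_cst.
- apply/cvgrNyPle => A; near=> x; rewrite /F -lerBrDr -ler_pdivlMl//.
- apply/cvgryPge => A; near=> x; rewrite /F -lerBlDr -ler_pdivrMl//.
Unshelve. all: by end_near. Qed.

Lemma is_derive_continuous (h h' : R -> R) :
  (forall x, is_derive x (1 : R) h (h' x)) -> continuous h.
Proof.
move=> dh x.
by have /derivable1_diffP/differentiable_continuous := @ex_derive _ _ _ _ _ _ _ (dh x).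
Qed.

Lemma normal_fun01E (x : R) : bell x = expR (- x ^+ 2 / 2).
Proof. by rewrite /normal_fun subr0 expr1n. Qed.

Lemma normal_fun01_0 : bell (0 : R) = 1.
Proof. by rewrite normal_fun01E expr0n/= oppr0 mul0r expR0. Qed.

Lemma is_derive_normal_fun01 (x : R) : is_derive x (1 : R) (bell : R -> R) (- x * bell x).
Proof.
have -> : (bell : R -> R) = expR \o (fun y : R => - (y ^+ 2 / 2)).
  by apply/funext => y; rewrite normal_fun01E mulNr.
have d1 : is_derive x (1 : R) (fun y : R => - (y ^+ 2 / 2)) (- x).
  by apply: is_derive_eq; rewrite /GRing.scale/=; field.
apply: is_derive_eq; rewrite /GRing.scale /=; ring.
Qed.

Lemma continuous_normal_fun01 : continuous (bell : R -> R).
Proof. exact: is_derive_continuous is_derive_normal_fun01. Qed.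

(** From exp (x^2 / 2) = exp (x^2 / 4)^2 >= (x^2 / 4)^2. *)
Lemma normal_fun01_decay (x : R) : 0 < x -> x ^+ 2 * bell x <= 16 / x ^+ 2.
Proof.
move=> x0; rewrite normal_fun01E ler_pdivlMr ?exprn_gt0// mulNr.
have -> : expR (- (x ^+ 2 / 2)) = (expR (x ^+ 2 / 4) ^+ 2)^-1.
  by rewrite expRN -expRM_natl; congr ((expR _)^-1); field.
have : 1 + x ^+ 2 / 4 <= expR (x ^+ 2 / 4) by exact: expR_ge1Dx.
have x20 : 0 <= x ^+ 2 by exact: sqr_ge0.
set E := expR _ => hE.
rewrite mulrAC ler_pdivrMr ?exprn_gt0 ?expR_gt0//.
have -> : x ^+ 2 * x ^+ 2 = 16 * (x ^+ 2 / 4) ^+ 2 by field.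
by rewrite ler_wpM2l// ler_pXn2r ?nnegrE//; lra.
Qed.

Lemma cvg_decay (h : R -> R) (C : R) : (forall x, 1 <= x -> `|h x| <= C / x ^+ 2) ->
  h x @[x --> +oo] --> (0 : R).
Proof.
move=> hC; apply/cvgrPdist_le => e e0; near=> x.
have x1 : 1 <= x by near: x; exact: nbhs_pinfty_ge.
have xC : C / e <= x by near: x; apply: nbhs_pinfty_ge; exact: num_real.
rewrite sub0r normrN; apply: le_trans (hC _ x1) _.
rewrite ler_pdivrMr ?exprn_gt0 ?(lt_le_trans ltr01)//.
rewrite ler_pdivrMr// in xC; apply: le_trans xC _; rewrite mulrC ler_pM2l//.
by rewrite expr2 ler_peMl// (le_trans ler01).
Unshelve. all: by end_near. Qed.

Lemma ge0_FTC_half_line (f F : R -> R) (l : R) : continuous f ->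
  (forall x, 0 <= x -> 0 <= f x) -> F x @[x --> +oo] --> l ->
  (forall x, is_derive x (1 : R) F (f x)) ->
  (\int[mu]_(x in `[0%R, +oo[) (f x)%:E = (l - F 0)%:E)%E.
Proof.
move=> cf f0 Fl dF.
have cF := is_derive_continuous dF.
rewrite (@ge0_continuous_FTC2y R f F 0 l) ?EFinB//.
- exact: continuous_subspaceT.
- by apply: cvg_at_right_filter; exact: cF.
- by move=> x _; rewrite derive1E derive_val.
Qed.

Lemma cvg_normal_fun01_poly (a b c : R) :
  (a + b * x + c * x ^+ 2) * bell x @[x --> +oo] --> (0 : R).
Proof.
apply: (@cvg_decay _ ((`|a| + `|b| + `|c|) * 16)) => x x1.
have x0 : 0 < x by lra.
have x2 : 1 <= x ^+ 2 by rewrite expr2 mulr_ege1.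
have xx2 : x <= x ^+ 2 by rewrite expr2 ler_peMl ?(ltW x0).
rewrite -mulrA; apply: (@le_trans _ _ ((`|a| + `|b| + `|c|) * (x ^+ 2 * bell x))); last first.
  by rewrite ler_wpM2l ?addr_ge0//; exact: normal_fun01_decay.
rewrite [leLHS]normrM (ger0_norm (normal_fun_ge0 0 1 x)) [leRHS]mulrA.
rewrite ler_wpM2r ?normal_fun_ge0//.
apply: le_trans (ler_normD _ _) _; apply: le_trans (lerD (ler_normD _ _) (lexx _)) _.
rewrite !mulrDl; apply: lerD; first apply: lerD.
- by rewrite ler_peMr.
- by rewrite normrM ler_wpM2l// gtr0_norm.
- by rewrite normrM (ger0_norm (sqr_ge0 x)).
Qed.

Lemma integral_half_cube : (\int[mu]_(x in `[0%R, +oo[) (x ^+ 3 * bell x)%:E = 2%:E)%E.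
Proof.
pose F (x : R) : R := - ((2 + 0 * x + 1 * x ^+ 2) * bell x).
have dF (x : R) : is_derive x (1 : R) F (x ^+ 3 * bell x).
  have de := is_derive_normal_fun01 x.
  by rewrite /F; apply: is_derive_eq; rewrite /GRing.scale/=; ring.
have F0 : F x @[x --> +oo] --> (0 : R).
  by rewrite -oppr0; apply: cvgN; exact: cvg_normal_fun01_poly.
rewrite (ge0_FTC_half_line _ _ F0 dF).
- congr EFin; rewrite /F normal_fun01_0 ?oppr0 ?expR0; ring.
- by move=> x; apply: cvgM; [exact: exprn_continuous|exact: continuous_normal_fun01].
- by move=> x x0; rewrite mulr_ge0 ?exprn_ge0 ?normal_fun_ge0.
Qed.

(** The primitive - x exp (- x^2 / 2) has derivative
(x^2 - 1) exp (- x^2 / 2), which changes sign.  Adding 2 exp (- x), whose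
integral over the half-line is 2, makes it nonnegative, as the fundamental
theorem on a half-line requires. *)
Lemma integral_half_sqr : (\int[mu]_(x in `[0%R, +oo[) (x ^+ 2 * bell x)%:E =
  \int[mu]_(x in `[0%R, +oo[) (bell x)%:E)%E.
Proof.
have dexp (x : R) : is_derive x (1 : R) (fun y : R => expR (- y)) (- expR (- x)).
  have -> : (fun y : R => expR (- y)) = expR \o (fun y : R => - y) by [].
  by apply: is_derive_eq; rewrite /GRing.scale/=; ring.
have cexp := is_derive_continuous dexp.
have exp0 : expR (- x) @[x --> +oo] --> (0 : R).
  exact: cvgr_expR.
have ce := continuous_normal_fun01.
have cx k : continuous (fun x : R => x ^+ k * bell x).
  by move=> x; apply: cvgM; [exact: exprn_continuous|exact: continuous_normal_fun01].
pose f (x : R) : R := x ^+ 2 * bell x + 2 * expR (- x) - bell x.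
pose F (x : R) : R := - ((0 + 1 * x + 0 * x ^+ 2) * bell x) - 2 * expR (- x).
have f0 x : 0 <= x -> 0 <= f x.
  move=> x0; have e0 := normal_fun_ge0 0 1 x; have E0 := expR_gt0 (- x).
  rewrite /f; have [x1|x1] := leP 1 x.
    have : 1 * bell x <= x ^+ 2 * bell x by rewrite ler_wpM2r// expr2 mulr_ege1.
    by lra.
  have e1 : bell x <= 1.
    rewrite normal_fun01E -[leRHS]expR0 ler_expR mulNr oppr_le0; have := sqr_ge0 x; lra.
  have E1 : 1 - x <= expR (- x) by exact: expR_ge1Dx.
  have x2 : x ^+ 2 <= 1 by rewrite exprn_ile1// ltW.
  have : (1 - x ^+ 2) * bell x <= (1 - x ^+ 2) * 1 by rewrite ler_wpM2l//; lra.
  have : 0 <= (1 - x) ^+ 2 by exact: sqr_ge0.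
  have -> : (1 - x) ^+ 2 = 1 - 2 * x + x ^+ 2 by ring.
  by lra.
have cf : continuous f.
  move=> x; apply: cvgB; last exact: ce.
  by apply: cvgD; [exact: cx|apply: cvgM; [exact: cvg_cst|exact: cexp]].
have If : (\int[mu]_(x in `[0%R, +oo[) (f x)%:E = 2%:E)%E.
  have dF (x : R) : is_derive x (1 : R) F (f x).
    have de := is_derive_normal_fun01 x; have := dexp x => dx.
    by rewrite /F /f; apply: is_derive_eq; rewrite /GRing.scale/=; ring.
  have F0 : F x @[x --> +oo] --> (0 : R).
    have E0 : (- 0 - 2 * 0 : R) = 0 by ring.
    rewrite -E0.
    apply: cvgB; first by apply: cvgN; exact: cvg_normal_fun01_poly.
    by apply: cvgM; [exact: cvg_cst|exact: exp0].
  rewrite (ge0_FTC_half_line _ _ F0 dF)//.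
  congr EFin; rewrite /F normal_fun01_0 ?oppr0 ?expR0; ring.
have Ie : (\int[mu]_(x in `[0%R, +oo[) (2 * expR (- x))%:E = 2%:E)%E.
  have dF (x : R) : is_derive x (1 : R) (fun y : R => - 2 * expR (- y)) (2 * expR (- x)).
    have := dexp x => dx.
    by apply: is_derive_eq; rewrite /GRing.scale/=; ring.
  have F0 : (- 2 * expR (- x)) @[x --> +oo] --> (0 : R).
    by rewrite -(mulr0 (- 2)); apply: cvgM; [exact: cvg_cst|exact: exp0].
  rewrite (ge0_FTC_half_line _ _ F0 dF)//.
  - by congr EFin; rewrite oppr0 expR0; ring.
  - by move=> x; apply: cvgM; [exact: cvg_cst|exact: cexp].
have mI : measurable (`[0, +oo[%classic : set R) by exact: measurable_itv.
have mc (h : R -> R) : continuous h -> measurable_fun (`[0, +oo[%classic : set R) (EFin \o h).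
  by move=> ch; apply/measurable_EFinP/measurable_funTS; exact: continuous_measurable_fun.
have : (\int[mu]_(x in `[0%R, +oo[) ((f x)%:E + (bell x)%:E) =
        \int[mu]_(x in `[0%R, +oo[) ((x ^+ 2 * bell x)%:E + (2 * expR (- x))%:E))%E.
  by apply: eq_integral => x _; rewrite -!EFinD /f; congr EFin; ring.
have cE : continuous (fun x => 2 * expR (- x) : R).
  by move=> x; apply: cvgM; [exact: cvg_cst|exact: cexp].
rewrite ge0_integralD//; first last.
- exact: mc.
- by move=> x _; rewrite lee_fin normal_fun_ge0.
- exact: mc.
- by move=> x /=; rewrite in_itv/= andbT => x0; rewrite lee_fin f0.
rewrite ge0_integralD//; first last.
- exact: mc.
- exact: (mc _ (cx 2)).
- by move=> x _; rewrite lee_fin mulr_ge0 ?sqr_ge0 ?normal_fun_ge0.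
rewrite If Ie addeC => /(congr1 (fun z => z - 2%:E)%E).
by rewrite !addeK.
Qed.

Definition gauss : probability (measurableTypeR R) R := normal_prob (0 : R) 1.

Lemma ge0_integral_gauss (h : R -> R) : continuous h -> (forall x, 0 <= h x) ->
  (\int[gauss]_x (h x)%:E = \int[mu]_x (h x * (normal_peak 1 * bell x))%:E)%E.
Proof.
move=> ch h0; rewrite ge0_integral_normal_prob//; last exact: continuous_measurable_fun.
by rewrite normal_pdfE ?oner_eq0.
Qed.

Lemma ge0_integral_gauss_even (h : R -> R) : continuous h -> (forall x, 0 <= h x) ->
  (forall x, h (- x) = h x) ->
  (\int[gauss]_x (h x)%:E =
   2%:E * ((normal_peak 1)%:E * \int[mu]_(x in `[0%R, +oo[) (h x * bell x)%:E))%E.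
Proof.
move=> ch h0 ev; rewrite ge0_integral_gauss//.
have pk0 := @normal_peak_ge0 R 1.
rewrite ge0_symfun_integralT.
- congr (_ * _)%E; rewrite -set_itvcy -ge0_integralZl//.
  + by apply: eq_integral => x _; rewrite -EFinM; congr EFin; ring.
  + apply/measurable_EFinP/measurable_funTS; apply: continuous_measurable_fun.
    by move=> x; apply: cvgM; [exact: ch|exact: continuous_normal_fun01].
  + by move=> x _; rewrite lee_fin mulr_ge0 ?normal_fun_ge0.
- by move=> x; rewrite !mulr_ge0 ?normal_fun_ge0.
- move=> x; apply: cvgM; first exact: ch.
  by apply: cvgM; [exact: cvg_cst|exact: continuous_normal_fun01].
- by move=> x /=; rewrite ev !normal_fun01E sqrrN.
Qed.

Lemma gauss_sqr : (\int[gauss]_x (x ^+ 2)%:E = 1%:E)%E.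
Proof.
rewrite ge0_integral_gauss_even; first last.
- by move=> x; rewrite sqrrN.
- by move=> x; exact: sqr_ge0.
- exact: exprn_continuous.
rewrite integral_half_sqr.
have -> : (\int[mu]_(x in `[0%R, +oo[) (bell x)%:E =
  \int[mu]_(x in `[0%R, +oo[) (cst 1%R x * bell x)%:E)%E.
  by apply: eq_integral => x _; rewrite mul1r.
rewrite -ge0_integral_gauss_even//; last by move=> x; exact: cvg_cst.
transitivity (\int[gauss]_x (cst 1%E x))%E; first by [].
by rewrite integral_cst//= probability_setT mule1.
Qed.

Lemma integrable_gauss_cube : gauss.-integrable [set: R] (fun x => (`|x| ^+ 3)%:E).
Proof.
have cn : continuous (fun x : R => `|x| ^+ 3).
  by move=> x; apply: (@continuous_comp _ _ _ (@Num.Def.normr _ R) (fun y => y ^+ 3));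
    [exact: norm_continuous|exact: exprn_continuous].
apply/integrableP; split.
  by apply/measurable_EFinP; exact: continuous_measurable_fun.
under eq_integral do rewrite abse_EFin ger0_norm ?exprn_ge0//.
rewrite ge0_integral_gauss_even//.
- under eq_integral => x.
    rewrite inE/= in_itv/= andbT => x0; rewrite ger0_norm//.
    over.
  by rewrite integral_half_cube -!EFinM ltry.
- by move=> x; rewrite normrN.
Qed.

Lemma integrable_gauss_sqr : gauss.-integrable [set: R] (fun x => (x ^+ 2)%:E).
Proof.
apply/integrableP; split.
  by apply/measurable_EFinP; apply: continuous_measurable_fun; exact: exprn_continuous.
under eq_integral do rewrite abse_EFin ger0_norm ?sqr_ge0//.
by rewrite gauss_sqr ltry.
Qed.

Lemma integrable_gauss_norm : gauss.-integrable [set: R] (fun x => `|x|%:E).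
Proof.
have I1 : gauss.-integrable [set: R] (EFin \o cst 1).
  exact: finite_measure_integrable_cst.
have I := integrableD measurableT I1 integrable_gauss_sqr.
apply: (le_integrable measurableT _ _ I).
  by apply/measurable_EFinP; apply: continuous_measurable_fun; exact: norm_continuous.
move=> x _; rewrite -EFinD !abse_EFin lee_fin normr_id.
rewrite (@ger0_norm _ (1 + _)) ?addr_ge0 ?sqr_ge0// -(real_normK (num_real x)).
have := sqr_ge0 (`|x| - 1); have := normr_ge0 x.
have -> : (`|x| - 1) ^+ 2 = `|x| ^+ 2 - 2 * `|x| + 1 by ring.
by lra.
Qed.

Lemma integrable_gauss_id : gauss.-integrable [set: R] (fun x => x%:E).
Proof.
apply: (le_integrable measurableT _ _ integrable_gauss_norm).
  by apply/measurable_EFinP; apply: continuous_measurable_fun => x; exact: cvg_id.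
by move=> x _; rewrite !abse_EFin lee_fin normr_id.
Qed.

Lemma continuous_pos_part : continuous (pos_part : R -> R).
Proof.
have -> : (pos_part : R -> R) = (fun y => (y + `|y|) / 2).
  apply/funext => y; case: (pos_partP y) => [] [y0 ->].
    by rewrite ger0_norm//; lra.
  by rewrite ler0_norm//; lra.
move=> x; apply: cvgM; last exact: cvg_cst.
by apply: cvgD; [exact: cvg_id|exact: norm_continuous].
Qed.

Lemma pos_part_ge0 (x : R) : 0 <= pos_part x.
Proof. by rewrite /pos_part le_max lexx orbT. Qed.

(** By symmetry, the positive part carries half of the first absolute moment. *)
Lemma gauss_norm_pos_part : (\int[gauss]_x `|x|%:E = 2%:E * \int[gauss]_x (pos_part x)%:E)%E.
Proof.
have pk0 := @normal_peak_ge0 R 1.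
rewrite ge0_integral_gauss_even//; last 2 first.
- exact: norm_continuous.
- by move=> x; rewrite normrN.
congr (_ * _)%E; rewrite (ge0_integral_gauss continuous_pos_part pos_part_ge0).
rewrite -ge0_integralZl//.
- rewrite integral_mkcond; apply: eq_integral => x _; rewrite patchE.
  have [|] := boolP (x \in `[0%R, +oo[%classic).
    rewrite inE/= in_itv/= andbT => x0.
    by rewrite ger0_norm// /pos_part max_l// -EFinM; congr EFin; ring.
  rewrite notin_setE/= in_itv/= andbT => /negP; rewrite -ltNge => x0.
  by rewrite /pos_part max_r ?mul0r// ltW.
- apply/measurable_EFinP/measurable_funTS; apply: continuous_measurable_fun.
  by move=> x; apply: cvgM; [exact: norm_continuous|exact: continuous_normal_fun01].
- by move=> x _; rewrite lee_fin mulr_ge0 ?normal_fun_ge0.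
Qed.

(** Here x = 2 max (x, 0) - |x|. *)
Lemma gauss_mean : \int[gauss]_x x = 0.
Proof.
have In := integrable_gauss_norm.
have Ip : gauss.-integrable [set: R] (EFin \o (pos_part : R -> R)).
  apply: (le_integrable measurableT _ _ In).
    by apply/measurable_EFinP; apply: continuous_measurable_fun; exact: continuous_pos_part.
  move=> x _; rewrite !abse_EFin lee_fin normr_id ger0_norm ?pos_part_ge0//.
  by case: (pos_partP x) => [] [x0 ->] //; rewrite ger0_norm.
have I2 := integrableZl measurableT 2 Ip.
transitivity (\int[gauss]_x (2 * pos_part x - `|x|)).
  apply: eq_Rintegral => x _; case: (pos_partP x) => [] [x0 ->].
    by rewrite ger0_norm//; ring.
  by rewrite ler0_norm//; ring.
have -> : \int[gauss]_x (2 * pos_part x - `|x|) =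
    \int[gauss]_x (2 * pos_part x) - \int[gauss]_x `|x|.
  exact: (RintegralB measurableT I2 In).
have -> : \int[gauss]_x (2 * pos_part x) = 2 * \int[gauss]_x pos_part x.
  exact: (RintegralZl _ measurableT Ip).
rewrite /Rintegral gauss_norm_pos_part fineM//; first by ring.
exact: (integrable_fin_num measurableT Ip).
Qed.

End Gaussian.

(** * The heat semigroup *)

Section Smoothing.
Context {R : realType}.
Implicit Types (f : R -> R).
Local Notation mu := (@lebesgue_measure R).
Local Notation bell := (normal_fun (0 : R) 1).
Local Notation gauss := (@gauss R).

(** The average of [f] over translations by [r] times a standard Gaussian, that
is the heat flow at time r^2 / 2.  Parametrizing by the standard deviation
covers r = 0. *)
Definition heat (r : R) f (x : R) : R := \int[gauss]_y f (x + r * y).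

Lemma integrable_gauss_shift f M (r x : R) : continuous f -> (forall y, `|f y| <= M) ->
  gauss.-integrable [set: R] (fun y => (f (x + r * y))%:E).
Proof.
move=> cf fM; apply: (@integrable_bounded _ _ (fun y => f (x + r * y)) M) => // y.
apply: continuous_comp; last exact: cf.
by apply: cvgD; [exact: cvg_cst|apply: cvgM; [exact: cvg_cst|exact: cvg_id]].
Qed.

Lemma Rintegral_sub (u v : R -> R) (a : R) :
  gauss.-integrable [set: R] (fun y => (u y)%:E) ->
  gauss.-integrable [set: R] (fun y => (v y)%:E) ->
  gauss.-integrable [set: R] (fun y => (u y - a * v y)%:E) /\
  \int[gauss]_y (u y - a * v y) = \int[gauss]_y u y - a * \int[gauss]_y v y.
Proof.
move=> Iu Iv; have Jv := integrableZl measurableT a Iv.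
split; first exact: (integrableB measurableT Iu Jv).
have <- : \int[gauss]_y (a * v y) = a * \int[gauss]_y v y.
  exact: (RintegralZl _ measurableT Iv).
exact: (RintegralB measurableT Iu Jv).
Qed.

Lemma Rintegral_diff (u v : R -> R) :
  gauss.-integrable [set: R] (fun y => (u y)%:E) ->
  gauss.-integrable [set: R] (fun y => (v y)%:E) ->
  gauss.-integrable [set: R] (fun y => (u y - v y)%:E) /\
  \int[gauss]_y (u y - v y) = \int[gauss]_y u y - \int[gauss]_y v y.
Proof.
move=> Iu Iv; split; first exact: (integrableB measurableT Iu Iv).
exact: (RintegralB measurableT Iu Iv).
Qed.

Lemma Rintegral_norm_le (u v : R -> R) :
  gauss.-integrable [set: R] (fun y => (u y)%:E) ->
  gauss.-integrable [set: R] (fun y => (v y)%:E) ->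
  (forall y, `|u y| <= v y) -> `|\int[gauss]_y u y| <= \int[gauss]_y v y.
Proof.
move=> Iu Iv uv; apply: le_trans (le_normr_Rintegral measurableT Iu) _.
by apply: le_Rintegral => //; exact: (integrable_norm Iu).
Qed.

Lemma integrable_gauss_cst (c : R) : gauss.-integrable [set: R] (fun y => c%:E).
Proof. exact: finite_measure_integrable_cst. Qed.

Lemma gauss_cst (c : R) : \int[gauss]_y c = c.
Proof. exact: Rintegral_cst_prob. Qed.

Lemma heat_bound f M r x : continuous f -> (forall y, `|f y| <= M) -> `|heat r f x| <= M.
Proof.
move=> cf fM; rewrite -(gauss_cst M); apply: Rintegral_norm_le => //.
- exact: integrable_gauss_shift fM.
- exact: integrable_gauss_cst.
Qed.

Lemma heat0 f x : heat 0 f x = f x.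
Proof.
by rewrite -(gauss_cst (f x)); apply: eq_Rintegral => y _; rewrite mul0r addr0.
Qed.

Lemma heat_taylor2 K f f1 f2 r : taylor2 K f f1 f2 ->
  taylor2 K (heat r f) (heat r f1) (heat r f2).
Proof.
move=> T; have [cf cf1 cf2] := taylor2_continuous T; have [bd t0 t1 t2] := T.
have b0 x : `|f x| <= K by have [] := bd x.
have b1 x : `|f1 x| <= K by have [] := bd x.
have b2 x : `|f2 x| <= K by have [] := bd x.
have I0 x := integrable_gauss_shift r x cf b0.
have I1 x := integrable_gauss_shift r x cf1 b1.
have I2 x := integrable_gauss_shift r x cf2 b2.
have Ic := integrable_gauss_cst.
have sh x y z : x + y + r * z = (x + r * z) + y by ring.
split=> [x|x y|x y|x y].
- by split; apply: heat_bound.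
- have [J0 E0] := Rintegral_diff (I0 (x + y)) (I0 x).
  have [J1 E1] := Rintegral_sub y J0 (I1 x).
  have [I E2] := Rintegral_sub (y ^+ 2 / 2) J1 (I2 x).
  rewrite /heat -E0 -E1 -E2.
  rewrite -[leRHS]gauss_cst; apply: Rintegral_norm_le => // z; rewrite sh; exact: t0.
- have [J0 E0] := Rintegral_diff (I1 (x + y)) (I1 x).
  have [I E1] := Rintegral_sub y J0 (I2 x).
  rewrite /heat -E0 -E1.
  rewrite -[leRHS]gauss_cst; apply: Rintegral_norm_le => // z.
  by rewrite sh; exact: t1.
- have [I E0] := Rintegral_diff (I2 (x + y)) (I2 x).
  rewrite /heat -E0.
  rewrite -[leRHS]gauss_cst; apply: Rintegral_norm_le => // z.
  by rewrite sh; exact: t2.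
Qed.

Definition gauss_absmoment (k : nat) : R := \int[gauss]_y (`|y| ^+ k).

(** Integrate the Taylor estimates: the first Gaussian moment is 0 and the second
one is 1. *)
Lemma heat_step K f f1 f2 (r x : R) : taylor2 K f f1 f2 -> 0 <= r ->
  [/\ `|heat r f x - f x - r ^+ 2 / 2 * f2 x| <= K * gauss_absmoment 3 * r ^+ 3,
      `|heat r f1 x - f1 x| <= K * r ^+ 2
    & `|heat r f2 x - f2 x| <= K * gauss_absmoment 1 * r].
Proof.
move=> T r0; have [cf cf1 cf2] := taylor2_continuous T; have [bd t0 t1 t2] := T.
have b0 y : `|f y| <= K by have [] := bd y.
have b1 y : `|f1 y| <= K by have [] := bd y.
have b2 y : `|f2 y| <= K by have [] := bd y.
have I0 := integrable_gauss_shift r x cf b0.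
have I1 := integrable_gauss_shift r x cf1 b1.
have I2 := integrable_gauss_shift r x cf2 b2.
have Ic := integrable_gauss_cst.
have Iid := @integrable_gauss_id R.
have Isq := @integrable_gauss_sqr R.
have m2 : \int[gauss]_y (y ^+ 2) = 1 by rewrite /Rintegral gauss_sqr.
split.
- have [J0 E0] := Rintegral_diff I0 (Ic (f x)).
  have [J1 E1] := Rintegral_sub (r * f1 x) J0 Iid.
  have [I E2] := Rintegral_sub (r ^+ 2 / 2 * f2 x) J1 Isq.
  rewrite E1 E0 gauss_cst gauss_mean m2 mulr0 subr0 mulr1 in E2.
  rewrite /heat -E2.
  have Iv := integrableZl measurableT (K * r ^+ 3) (@integrable_gauss_cube R).
  have -> : K * gauss_absmoment 3 * r ^+ 3 = \int[gauss]_y (K * r ^+ 3 * `|y| ^+ 3).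
    rewrite mulrAC; apply/esym; exact: (RintegralZl _ measurableT (@integrable_gauss_cube R)).
  apply: Rintegral_norm_le => // y; have := t0 x (r * y).
  rewrite normrM (ger0_norm r0) [(r * `|y|) ^+ 3]exprMn (mulrA K); apply: le_trans.
  by rewrite le_eqVlt; apply/orP; left; apply/eqP; congr `|_|; ring.
- have [J0 E0] := Rintegral_diff I1 (Ic (f1 x)).
  have [I E1] := Rintegral_sub (r * f2 x) J0 Iid.
  rewrite E0 gauss_cst gauss_mean mulr0 subr0 in E1.
  rewrite /heat -E1.
  have Iv := integrableZl measurableT (K * r ^+ 2) Isq.
  have -> : K * r ^+ 2 = \int[gauss]_y (K * r ^+ 2 * y ^+ 2).
    rewrite -{1}[K * _]mulr1 -m2; apply/esym; exact: (RintegralZl _ measurableT Isq).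
  apply: Rintegral_norm_le => // y; have := t1 x (r * y).
  rewrite exprMn (mulrA K); apply: le_trans.
  by rewrite le_eqVlt; apply/orP; left; apply/eqP; congr `|_|; ring.
- have [I E0] := Rintegral_diff I2 (Ic (f2 x)).
  rewrite gauss_cst in E0; rewrite /heat -E0.
  have In : gauss.-integrable [set: R] (fun y => (`|y| ^+ 1)%:E).
    exact: integrable_gauss_norm.
  have Iv := integrableZl measurableT (K * r) In.
  have -> : K * gauss_absmoment 1 * r = \int[gauss]_y (K * r * `|y| ^+ 1).
    rewrite mulrAC; apply/esym; exact: (RintegralZl _ measurableT In).
  apply: Rintegral_norm_le => // y; have := t2 x (r * y).
  by rewrite normrM (ger0_norm r0) mulrA expr1.
Qed.

(** For independent standard Gaussian Y and Z, the pair formed by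
X = (r Y + t Z) / rho and Y has the density on the left; the right-hand side
disintegrates it as the law of X times the conditional law of Y. *)
Lemma gauss_rotation (r t x y : R) : 0 < t ->
  let rho := Num.sqrt (r ^+ 2 + t ^+ 2) in
  (rho / t) * (normal_peak 1 * bell ((rho * x - r * y) / t)) * (normal_peak 1 * bell y) =
  normal_peak 1 * bell x * normal_pdf (r * x / rho) (t / rho) y.
Proof.
move=> t0 rho.
have s0 : 0 < r ^+ 2 + t ^+ 2 by rewrite ltr_wpDl ?sqr_ge0 ?exprn_gt0.
have rho0 : 0 < rho by rewrite sqrtr_gt0.
have rho2 : rho ^+ 2 = r ^+ 2 + t ^+ 2 by rewrite sqr_sqrtr// ltW.
have tr0 : 0 < t / rho by rewrite divr_gt0.
have nt : t != 0 by rewrite gt_eqF.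
have nrho : rho != 0 by rewrite gt_eqF.
rewrite normal_pdfE ?gt_eqF//.
have -> : normal_peak (t / rho) = rho / t * normal_peak 1.
  rewrite /normal_peak expr1n mul1r -mulrnAr sqrtrM ?sqr_ge0// sqrtr_sqr gtr0_norm//.
  by rewrite invfM invf_div.
rewrite !normal_fun01E /normal_fun.
have E : expR (- ((rho * x - r * y) / t) ^+ 2 / 2) * expR (- y ^+ 2 / 2) =
  expR (- x ^+ 2 / 2) * expR (- (y - r * x / rho) ^+ 2 / ((t / rho) ^+ 2 *+ 2)).
  rewrite -!expRD !mulNr; congr expR.
  have -> : (y - r * x / rho) ^+ 2 / ((t / rho) ^+ 2 *+ 2) = (rho * y - r * x) ^+ 2 / t ^+ 2 / 2.
    by field; rewrite nt nrho.
  have -> : ((rho * x - r * y) / t) ^+ 2 = (rho * x - r * y) ^+ 2 / t ^+ 2 by field.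
  have -> : y ^+ 2 = t ^+ 2 * y ^+ 2 / t ^+ 2 by field.
  have -> : x ^+ 2 = t ^+ 2 * x ^+ 2 / t ^+ 2 by field.
  rewrite -!opprD -!mulrDl; congr (- (_ / _ / _)).
  have e (u v : R) : (rho * u - r * v) ^+ 2 =
    rho ^+ 2 * u ^+ 2 - 2 * rho * r * u * v + r ^+ 2 * v ^+ 2.
    by ring.
  by rewrite !e rho2; ring.
have := congr1 (fun z => rho / t * normal_peak 1 * normal_peak 1 * z) E.
move=> H; apply: etrans (etrans H _); ring.
Qed.

(** The sum of two independent Gaussians is Gaussian: substitute
rho w = r y + t z in the inner integral, exchange the integrals by Tonelli, and
integrate the conditional density of [gauss_rotation] in y. *)
Lemma heat_heat_ge0 K f f1 f2 (r t x : R) : taylor2 K f f1 f2 -> (forall y, 0 <= f y) -> 0 < t ->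
  heat r (heat t f) x = heat (Num.sqrt (r ^+ 2 + t ^+ 2)) f x.
Proof.
move=> T f0 t0; set rho := Num.sqrt _.
have s0 : 0 < r ^+ 2 + t ^+ 2 by rewrite ltr_wpDl ?sqr_ge0 ?exprn_gt0.
have rho0 : 0 < rho by rewrite sqrtr_gt0.
have [cf _ _] := taylor2_continuous T.
have [cg _ _] := taylor2_continuous (heat_taylor2 t T).
have b0 y : `|f y| <= K by have [/(_ y)[]] := T.
have g0 y : 0 <= heat t f y by exact: Rintegral_ge0.
have caff (h : R -> R) (a b : R) : continuous h -> continuous (fun y => h (a + b * y)).
  move=> ch y; apply: continuous_comp; last exact: ch.
  by apply: cvgD; [exact: cvg_cst|apply: cvgM; [exact: cvg_cst|exact: cvg_id]].
pose p (y : R) : R := normal_peak 1 * bell y.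
have cp : continuous p.
  by move=> y; apply: cvgM; [exact: cvg_cst|exact: continuous_normal_fun01].
have p0 (y : R) : 0 <= p y.
  by rewrite /p mulr_ge0 ?normal_peak_ge0 ?normal_fun_ge0.
have rt0 : 0 < rho / t by exact: divr_gt0.
have inner y : ((heat t f (x + r * y))%:E =
    \int[mu]_w (rho / t * (f (x + rho * w) * p ((rho * w - r * y) / t)))%:E)%E.
  rewrite /heat /Rintegral fineK; last first.
    by apply: (integrable_fin_num measurableT); exact: (integrable_gauss_shift t (x + r * y) cf b0).
  rewrite ge0_integral_gauss//; last exact: caff.
  pose G (z : R) : R := f (x + r * y + t * z) * p z.
  have cG : continuous G by move=> z; apply: cvgM; [exact: caff|exact: cp].
  have G0 z : 0 <= G z by rewrite mulr_ge0.
  transitivity (\int[mu]_z (G z)%:E)%E; first by [].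
  rewrite (ge0_integral_affine (- (r / t) * y) rt0 cG G0).
  apply: eq_integral => w _; rewrite /G; congr (_ * (f _ * p _))%:E; first by field; rewrite gt_eqF.
  by field; rewrite gt_eqF.
rewrite {1}/heat /Rintegral; congr fine.
rewrite ge0_integral_gauss//; last exact: caff.
rewrite [RHS]ge0_integral_gauss//; last exact: caff.
pose F (yw : R * R) : \bar R :=
  (rho / t * (f (x + rho * yw.2) * p ((rho * yw.2 - r * yw.1) / t)) * p yw.1)%:E.
have F0 yw : (0 <= F yw)%E.
  by rewrite lee_fin; apply: mulr_ge0 => //; apply: mulr_ge0; [exact: ltW|exact: mulr_ge0].
have mp : measurable_fun [set: R] p by exact: continuous_measurable_fun.
have mf : measurable_fun [set: R] f by exact: continuous_measurable_fun.
have mF : measurable_fun [set: R * R] F.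
  apply/measurable_EFinP; apply: measurable_funM; last exact: measurableT_comp.
  apply: measurable_funM => //; apply: measurable_funM.
    apply: measurableT_comp => //; apply: measurable_funD => //.
    by apply: measurable_funM => //.
  apply: measurableT_comp => //; apply: measurable_funM => //.
  by apply: measurable_funB; apply: measurable_funM => //.
transitivity (\int[mu]_y \int[mu]_w F (y, w))%E.
  apply: eq_integral => y _; rewrite EFinM inner -ge0_integralZr//.
  - apply/measurable_EFinP; apply: measurable_funM => //; apply: measurable_funM.
      by apply: measurableT_comp => //; apply: measurable_funD => //.
    apply: measurableT_comp => //; apply: measurable_funM => //.
    by apply: measurable_funB => //; apply: measurable_funM => //.
  - by move=> w _; rewrite lee_fin; apply: mulr_ge0; [exact: ltW|exact: mulr_ge0].
  - by rewrite lee_fin; exact: p0.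
transitivity (\int[mu]_w \int[mu]_y F (y, w))%E.
  exact: (fubini_tonelli (m1 := mu) (m2 := mu)).
apply: eq_integral => w _.
transitivity (\int[mu]_y ((f (x + rho * w) * p w)%:E *
  (normal_pdf (r * w / rho) (t / rho) y)%:E))%E.
  apply: eq_integral => y _; rewrite /F /= -EFinM; congr EFin.
  have := gauss_rotation r w y t0; rewrite /= -/rho => H.
  by rewrite -[RHS]mulrA -H /p; ring.
rewrite ge0_integralZl//; last 3 first.
- by apply/measurable_EFinP; exact: measurable_normal_pdf.
- by move=> y _; rewrite lee_fin normal_pdf_ge0.
- by rewrite lee_fin mulr_ge0.
by rewrite integral_normal_pdf mule1.
Qed.

Lemma heat_addc f M (c r x : R) : continuous f -> (forall y, `|f y| <= M) ->
  heat r (fun y => f y + c) x = heat r f x + c.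
Proof.
move=> cf fM; rewrite -[in RHS](gauss_cst c).
exact: (RintegralD measurableT (integrable_gauss_shift r x cf fM) (integrable_gauss_cst c)).
Qed.

Lemma taylor2_addc K f f1 f2 c : taylor2 K f f1 f2 ->
  taylor2 (K + `|c|) (fun x => f x + c) f1 f2.
Proof.
move=> [bd t0 t1 t2]; have c0 := normr_ge0 c; split=> [x|x y|x y|x y].
- have [b0 b1 b2] := bd x; split; last 2 first.
  + by apply: le_trans b1 _; rewrite lerDl.
  + by apply: le_trans b2 _; rewrite lerDl.
  + by apply: le_trans (ler_normD _ _) (lerD b0 _).
- rewrite (_ : f (x + y) + c - _ = f (x + y) - f x); last by ring.
  by apply: le_trans (t0 x y) _; rewrite ler_wpM2r// lerDl.
- by apply: le_trans (t1 x y) _; rewrite ler_wpM2r ?sqr_ge0// lerDl.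
- by apply: le_trans (t2 x y) _; rewrite ler_wpM2r// lerDl.
Qed.

Lemma heat_heat K f f1 f2 (r t x : R) : taylor2 K f f1 f2 -> 0 <= r -> 0 <= t ->
  heat r (heat t f) x = heat (Num.sqrt (r ^+ 2 + t ^+ 2)) f x.
Proof.
move=> T r0; rewrite le_eqVlt => /predU1P[<-|t0].
  rewrite expr0n/= addr0 sqrtr_sqr ger0_norm//.
  by congr heat; apply/funext => y; rewrite heat0.
have [cf _ _] := taylor2_continuous T.
have [cg _ _] := taylor2_continuous (heat_taylor2 t T).
have b0 y : `|f y| <= K by have [/(_ y)[]] := T.
have gb y : `|heat t f y| <= K by exact: heat_bound.
(* Adding K makes [f] nonnegative. *)
apply: (addIr K); rewrite -(heat_addc _ _ _ cg gb) -(heat_addc _ _ _ cf b0).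
rewrite -(heat_heat_ge0 r x (taylor2_addc K T) _ t0).
  by congr heat; apply/funext => y; rewrite (heat_addc _ _ _ cf b0).
by move=> y; have := b0 y; rewrite ler_norml => /andP[]; lra.
Qed.

Lemma iter_heat K f f1 f2 (r : R) n : taylor2 K f f1 f2 -> 0 <= r ->
  iter n (heat r) f = heat (Num.sqrt n%:R * r) f.
Proof.
move=> T r0; elim: n => [|n IH] /=.
  by apply/funext => x; rewrite sqrtr0 mul0r heat0.
rewrite IH; apply/funext => x; rewrite (heat_heat _ T)//; last by rewrite mulr_ge0.
congr (heat _ f x).
rewrite exprMn sqr_sqrtr// -[in RHS](ger0_norm r0) -sqrtr_sqr -sqrtrM//.
by congr Num.sqrt; rewrite -natr1; ring.
Qed.

Lemma normal_pdf_scale (s y : R) : 0 < s ->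
  s * normal_pdf 0 s (s * y + 0) = normal_peak 1 * bell y.
Proof.
move=> s0; have ns : s != 0 by rewrite gt_eqF.
rewrite normal_pdfE// addr0 mulrA; congr (_ * _).
  rewrite /normal_peak expr1n mul1r -mulrnAr sqrtrM ?sqr_ge0// sqrtr_sqr gtr0_norm//.
  by rewrite invfM mulrA divff ?mul1r.
by rewrite normal_fun01E /normal_fun subr0; congr expR; field.
Qed.

Lemma ge0_integral_normal_scale (h : R -> R) (s : R) : 0 < s -> continuous h ->
  (forall y, 0 <= h y) ->
  (\int[normal_prob 0 s]_x (h x)%:E = \int[gauss]_x (h (0 + s * x))%:E)%E.
Proof.
move=> s0 ch h0.
rewrite ge0_integral_normal_prob//; last exact: continuous_measurable_fun.
rewrite (@ge0_integral_gauss _ (fun x => h (0 + s * x))) => [|y|//]; last first.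
  apply: (@continuous_comp _ _ _ (fun y => 0 + s * y)); last exact: ch.
  by apply: cvgD; [exact: cvg_cst|apply: cvgM; [exact: cvg_cst|exact: cvg_id]].
have cp : continuous (normal_pdf 0 s) by apply: continuous_normal_pdf; rewrite gt_eqF.
pose G (y : R) : R := h y * normal_pdf 0 s y.
have cG : continuous G by move=> z; apply: cvgM; [exact: ch|exact: cp].
have G0 z : 0 <= G z by rewrite mulr_ge0// normal_pdf_ge0.
transitivity (\int[mu]_z (G z)%:E)%E; first by [].
rewrite (ge0_integral_affine 0 s0 cG G0); apply: eq_integral => y _.
by rewrite /G mulrCA normal_pdf_scale// addr0 add0r.
Qed.

Lemma Rintegral_normal_prob K f f1 f2 (s : R) : taylor2 K f f1 f2 -> 0 < s ->
  \int[(normal_prob 0 s : probability (measurableTypeR R) R)]_x f x = heat s f 0.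
Proof.
move=> T s0; set P : probability (measurableTypeR R) R := normal_prob 0 s.
have [cf _ _] := taylor2_continuous T.
have b0 y : `|f y| <= K by have [/(_ y)[]] := T.
(* The change of variables is for nonnegative functions, hence [f + K]. *)
pose h y := f y + K.
have h0 y : 0 <= h y by have := b0 y; rewrite ler_norml /h => /andP[]; lra.
have ch : continuous h by move=> y; apply: cvgD; [exact: cf|exact: cvg_cst].
have If : P.-integrable [set: R] (EFin \o f) by exact: integrable_bounded b0.
have Ic : P.-integrable [set: R] (EFin \o cst K) by exact: finite_measure_integrable_cst.
have E1 : heat s f 0 + K = heat s h 0 by exact: (esym (heat_addc K s 0 cf b0)).
have E2 : \int[P]_x h x = \int[P]_x f x + \int[P]_x K.
  exact: (RintegralD measurableT If Ic).
have E3 : \int[P]_x K = K by exact: Rintegral_cst_prob.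
have E4 : \int[P]_x h x = heat s h 0.
  by apply: (congr1 fine); exact: ge0_integral_normal_scale.
have cancel (a b c d e : R) : b + K = d -> c = a + e -> e = K -> c = d -> a = b.
  by move=> H1 H2 H3 H4; apply: (addIr K); rewrite H1 -H4 H2 H3.
exact: (cancel _ _ _ _ _ E1 E2 E3 E4).
Qed.

Lemma Rintegral_normal0 K f f1 f2 (v : R) : taylor2 K f f1 f2 -> 0 <= v ->
  \int[normal0 v]_x f x = heat (Num.sqrt v) f 0.
Proof.
move=> T v_ge0; rewrite /normal0.
have [v0|vn0] := boolP (v == 0); last first.
  have s0 : 0 < Num.sqrt v by rewrite sqrtr_gt0 lt_neqAle eq_sym vn0.
  exact: (Rintegral_normal_prob T s0).
have [cf _ _] := taylor2_continuous T.
rewrite (eqP v0) sqrtr0 heat0 /Rintegral integral_dirac//=.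
  by rewrite indicT mul1r.
by apply/measurable_EFinP; exact: continuous_measurable_fun.
Qed.
End Smoothing.

(** * A central limit theorem for finite Markov chains *)

Lemma cvg_inv_sqrt {R : realType} : (Num.sqrt (n.+1%:R : R))^-1 @[n --> \oo] --> (0 : R).
Proof.
apply/cvgrPdist_le => d d0; near=> n.
rewrite sub0r normrN ger0_norm ?invr_ge0// invf_ple ?posrE ?sqrtr_gt0//.
rewrite -(ger0_norm (ltW (_ : 0 < d^-1))) ?invr_gt0// -sqrtr_sqr ler_wsqrtr//.
have : d^-1 ^+ 2 <= n%:R by near: n; exact: nbhs_infty_ger.
by move/le_trans; apply; rewrite ler_nat.
Unshelve. all: by end_near. Qed.

Section Chain.
Context {R : realType} (T : finType).
Variables (Q : T -> T -> R) (g : T -> R).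
Hypothesis Q0 : forall z z', 0 <= Q z z'.
Hypothesis Q1 : forall z, \sum_z' Q z z' = 1.

Definition markov_op (h : T -> R) (z : T) : R := \sum_z' Q z z' * h z'.

(** The backward operator of the chain together with the running sum: the n-th
iterate of F at (x, z) is the expectation of F (x + a (g Z_1 + ... + g Z_n), Z_n)
for the chain started at z. *)
Definition walk_op (a : R) (F : R -> T -> R) (x : R) (z : T) : R :=
  \sum_z' Q z z' * F (x + a * g z') z'.

Lemma mean_dist (u v : T -> R) (e : R) z : (forall z', `|u z' - v z'| <= e) ->
  `|\sum_z' Q z z' * u z' - \sum_z' Q z z' * v z'| <= e.
Proof.
move=> uv; rewrite -sumrB; apply: le_trans (ler_norm_sum _ _ _) _.
rewrite -[leRHS]mul1r -(Q1 z) mulr_suml; apply: ler_sum => z' _.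
by rewrite -mulrBr normrM ger0_norm// ler_wpM2l.
Qed.

Lemma mean_cst (c : R) z : \sum_z' Q z z' * c = c.
Proof. by rewrite -mulr_suml Q1 mul1r. Qed.

Lemma mean_affine (b c1 c2 : R) (u v : T -> R) z :
  \sum_z' Q z z' * (b + c1 * u z' + c2 * v z') =
  b + c1 * \sum_z' Q z z' * u z' + c2 * \sum_z' Q z z' * v z'.
Proof.
rewrite !mulr_sumr -{2}(mean_cst b z) -!big_split/=.
by apply: eq_bigr => z' _; ring.
Qed.

Lemma walk_op_dist a F F' e : (forall x z, `|F x z - F' x z| <= e) ->
  forall x z, `|walk_op a F x z - walk_op a F' x z| <= e.
Proof. by move=> FF x z; exact: mean_dist. Qed.

Lemma iter_walk_op_dist a n F F' e : (forall x z, `|F x z - F' x z| <= e) ->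
  forall x z, `|iter n (walk_op a) F x z - iter n (walk_op a) F' x z| <= e.
Proof. by move=> FF; elim: n => //= n IH; exact: walk_op_dist. Qed.

Lemma iter_walk_opZ a n F c : iter n (walk_op a) (fun x z => c * F x z) =
  fun x z => c * iter n (walk_op a) F x z.
Proof.
elim: n => //= n ->; apply/funext => x; apply/funext => z.
by rewrite /walk_op mulr_sumr; apply: eq_bigr => z' _; rewrite mulrCA.
Qed.

Lemma iter_markov_op_affine k (b d : R) (u : T -> R) z :
  iter k markov_op (fun z => b + d * u z) z = b + d * iter k markov_op u z.
Proof.
elim: k z => //= k IH z; rewrite /markov_op.
under eq_bigr do rewrite IH -[X in _ * X]addr0 -[X in _ + X](mul0r (0 : R)).
by rewrite (mean_affine b d 0 (iter k markov_op u) (fun=> 0) z) mul0r addr0.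
Qed.

Lemma markov_op_ge0 (u : T -> R) : (forall z, 0 <= u z) -> forall z, 0 <= markov_op u z.
Proof. by move=> u0 z; apply: sumr_ge0 => z' _; rewrite mulr_ge0. Qed.

Lemma iter_markov_op_ge0 k (u : T -> R) :
  (forall z, 0 <= u z) -> forall z, 0 <= iter k markov_op u z.
Proof. by move=> u0; elim: k => //= k IH; exact: markov_op_ge0. Qed.

(** From [z], the chain is at [z0] after [k] steps with positive probability;
[d] is a lower bound of it, and nonnegative test functions stand for the entries
of the k-th power of the transition matrix. *)
Definition hits (z0 : T) (k : nat) (z : T) :=
  exists2 d : R, 0 < d & forall u, (forall z, 0 <= u z) -> d * u z0 <= iter k markov_op u z.

Lemma hits0 z0 : hits z0 0 z0.
Proof. by exists 1 => // u _; rewrite mul1r. Qed.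

Lemma hitsS z0 k z z' : 0 < Q z z' -> hits z0 k z' -> hits z0 k.+1 z.
Proof.
move=> Qzz' [d d0 dP]; exists (Q z z' * d); first exact: mulr_gt0.
move=> u u0 /=; rewrite /markov_op (bigD1 z')//= -mulrA.
apply: le_trans (_ : Q z z' * iter k markov_op u z' <= _); first by rewrite ler_pM2l// dP.
by rewrite lerDl sumr_ge0// => y _; rewrite mulr_ge0// iter_markov_op_ge0.
Qed.

Variables (p : T -> R).
Hypothesis p0 : forall z, 0 <= p z.
Hypothesis p1 : \sum_z p z = 1.
Hypothesis pQ : forall z', \sum_z p z * Q z z' = p z'.

Definition stat_mean (u : T -> R) := \sum_z p z * u z.

Lemma stat_mean_markov_op u : stat_mean (markov_op u) = stat_mean u.
Proof.
rewrite /stat_mean /markov_op; under eq_bigr do rewrite mulr_sumr.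
rewrite exchange_big/=; apply: eq_bigr => z' _.
by under eq_bigr do rewrite mulrA; rewrite -mulr_suml pQ.
Qed.

(** Doeblin's argument: [k] steps of the chain keep a fraction at most 1 - d of
the distance of [w] to the constants, and the limiting constant is the
stationary mean because that mean is invariant. *)
Lemma mixing z0 k (w : T -> R) (e : R) : (forall z, hits z0 k z) -> 0 < e ->
  exists j, forall z, `|iter j markov_op w z - stat_mean w| <= e.
Proof.
move=> hk e0.
have [d /andP[d0 d1] dP] : exists2 d : R, 0 < d <= 1 & forall u z, (forall z, 0 <= u z) ->
    d * u z0 <= iter k markov_op u z.
  have /boolp.choice [D DP] : forall z, exists d : R, 0 < d /\ forall u, (forall z, 0 <= u z) ->
     d * u z0 <= iter k markov_op u z by move=> z; have [d ? ?] := hk z; exists d.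
  exists (\big[Num.min/1]_z D z).
    by rewrite bigmin_le_id andbT; apply/bigmin_gtP; split=> // z _; have [] := DP z.
  move=> u z u0; have [_ /(_ u u0)] := DP z; apply: le_trans.
  by rewrite ler_wpM2r// bigmin_le_cond.
pose r := 1 - d.
(* If u is within b of c, apply the lower bound [dP] to the nonnegative functions
   c + b - u and u - (c - b). *)
have contr u c b : (forall z, `|u z - c| <= b) ->
    exists c', forall z, `|iter k markov_op u z - c'| <= r * b.
  move=> uc; exists (d * u z0 + r * c) => z.
  have up : d * (c + b + (-1) * u z0) <= c + b + (-1) * iter k markov_op u z.
    rewrite -(iter_markov_op_affine k (c + b) (-1)); apply: (dP (fun z => c + b + (-1) * u z)).
    by move=> y; have := uc y; rewrite ler_norml => /andP[_]; lra.
  have lo : d * (b - c + 1 * u z0) <= b - c + 1 * iter k markov_op u z.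
    rewrite -(iter_markov_op_affine k (b - c) 1); apply: (dP (fun z => b - c + 1 * u z)).
    by move=> y; have := uc y; rewrite ler_norml => /andP[+ _]; lra.
  by rewrite ler_norml /r; lra.
pose b := \sum_z `|w z|.
have iterc j : exists c, forall z, `|iter (j * k) markov_op w z - c| <= r ^+ j * b.
  elim: j => [|j [c cP]].
    by exists 0 => z; rewrite subr0 mul1r /b (bigD1 z)//= lerDl sumr_ge0.
  have [c' c'P] := contr _ _ _ cP.
  by exists c' => z; rewrite mulSn iterD exprS -mulrA.
have b0 : 0 <= b by rewrite sumr_ge0.
have rj : r ^+ j @[j --> \oo] --> (0 : R).
  by apply: cvg_expr; rewrite /r ger0_norm; lra.
have e' : 0 < e / (2 * (b + 1)) by rewrite divr_gt0// mulr_gt0// ltr_wpDl.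
have /cvgrPdist_le/(_ _ e')[j _ /(_ j (leqnn j))] := rj.
rewrite sub0r normrN ger0_norm; last by rewrite exprn_ge0// /r; lra.
rewrite ler_pdivlMr ?mulr_gt0 ?ltr_wpDl// => rje.
have [c cP] := iterc j; exists (j * k)%N => z.
have pm : `|stat_mean w - c| <= r ^+ j * b.
  have -> : stat_mean w = stat_mean (iter (j * k) markov_op w).
    by elim: (j * k)%N => //= i ->; rewrite stat_mean_markov_op.
  rewrite -[c]mul1r -p1 mulr_suml /stat_mean -sumrB.
  apply: le_trans (ler_norm_sum _ _ _) _.
  rewrite -[leRHS]mul1r -p1 mulr_suml; apply: ler_sum => y _.
  by rewrite -mulrBr normrM ger0_norm// ler_wpM2l.
have := ler_distD c (iter (j * k) markov_op w z) (stat_mean w).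
rewrite (distrC c); have := cP z.
have : 0 <= r ^+ j by rewrite exprn_ge0// /r; lra.
lra.
Qed.

Section Corrector.
Variables (h1 h2 : T -> R) (s : R).
Hypothesis h1E : forall z, h1 z = markov_op (fun z' => g z' + h1 z') z.
Hypothesis h2E : forall z,
  h2 z + s / 2 = markov_op (fun z' => g z' ^+ 2 / 2 + g z' * h1 z' + h2 z') z.

(** The correctors [h1] and [h2] solve Poisson equations, chosen so that one step
of the chain changes this perturbation of [f] by a term that depends on the
position only, up to order 3 in [a]. *)
Definition corrected (a : R) (f f1 f2 : R -> R) (x : R) (z : T) : R :=
  f x + a * f1 x * h1 z + a ^+ 2 * f2 x * h2 z.

Variable B : R.
Hypothesis B1 : 1 <= B.
Hypothesis gB : forall z, `|g z| <= B.
Hypothesis h1B : forall z, `|h1 z| <= B.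
Hypothesis h2B : forall z, `|h2 z| <= B.

(** Expand to order 2 at [x] under the sum over the next state: the terms of order
1 and 2 are those of the Poisson equations [h1E] and [h2E]. *)
Lemma walk_op_corrected K f f1 f2 (a x : R) z : taylor2 K f f1 f2 -> 0 <= a ->
  `|walk_op a (corrected a f f1 f2) x z - (corrected a f f1 f2 x z + a ^+ 2 * (s / 2) * f2 x)|
    <= 3 * B ^+ 3 * K * a ^+ 3.
Proof.
move=> TT a0; have K0 := taylor2_ge0 TT; have [bd t0 t1 t2] := TT.
have B0 : 0 <= B by exact: le_trans ler01 B1.
have -> : corrected a f f1 f2 x z + a ^+ 2 * (s / 2) * f2 x = \sum_z' Q z z' *
  (f x + a * f1 x * (g z' + h1 z') +
   a ^+ 2 * f2 x * (g z' ^+ 2 / 2 + g z' * h1 z' + h2 z')).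
  rewrite mean_affine -/(markov_op (fun z' => g z' + h1 z') z) -h1E.
  rewrite -/(markov_op (fun z' => g z' ^+ 2 / 2 + g z' * h1 z' + h2 z') z) -h2E.
  by rewrite /corrected; ring.
apply: mean_dist => z'.
set y := a * g z'.
rewrite (_ : corrected _ _ _ _ _ _ - _ =
  (f (x + y) - f x - y * f1 x - y ^+ 2 / 2 * f2 x) +
  (a * h1 z') * (f1 (x + y) - f1 x - y * f2 x) +
  (a ^+ 2 * h2 z') * (f2 (x + y) - f2 x)); last by rewrite /corrected /y; field.
have yB : `|y| <= a * B by rewrite normrM ger0_norm// ler_wpM2l.
have aB0 : 0 <= a * B by rewrite mulr_ge0.
have y2 : `|y| ^+ 2 <= (a * B) ^+ 2 by rewrite ler_pXn2r ?nnegrE.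
have y3 : `|y| ^+ 3 <= (a * B) ^+ 3 by rewrite ler_pXn2r ?nnegrE.
apply: le_trans (ler_normD _ _) _; apply: le_trans (lerD (ler_normD _ _) (lexx _)) _.
have -> : 3 * B ^+ 3 * K * a ^+ 3 = K * (a * B) ^+ 3 + a * B * (K * (a * B) ^+ 2)
   + a ^+ 2 * B ^+ 2 * (K * (a * B)) by ring.
apply: lerD; first apply: lerD.
- by apply: le_trans (t0 x y) _; rewrite ler_wpM2l.
- rewrite normrM; apply: ler_pM => //.
    by rewrite normrM (ger0_norm a0) ler_wpM2l.
  by apply: le_trans (t1 x y) _; rewrite -(real_normK (num_real y)) ler_wpM2l.
- rewrite normrM; apply: ler_pM => //.
    rewrite normrM normrX (ger0_norm a0) ler_wpM2l ?exprn_ge0//.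
    by apply: le_trans (h2B z') _; rewrite expr2 ler_peMr.
  by apply: le_trans (t2 x y) _; rewrite ler_wpM2l.
Qed.

Variable sg : R.
Hypothesis sg0 : 0 <= sg.
Hypothesis sgE : sg ^+ 2 = s.

Lemma gauss_absmoment_ge0 k : 0 <= @gauss_absmoment R k.
Proof. by apply: Rintegral_ge0 => y _; exact: exprn_ge0. Qed.

(** The heat flow over the time of one step has the same expansion. *)
Lemma corrected_heat K f f1 f2 (a x : R) z : taylor2 K f f1 f2 -> 0 <= a ->
  `|corrected a (heat (a * sg) f) (heat (a * sg) f1) (heat (a * sg) f2) x z
    - (corrected a f f1 f2 x z + a ^+ 2 * (s / 2) * f2 x)|
  <= (gauss_absmoment 3 * sg ^+ 3 + B * sg ^+ 2 + B * gauss_absmoment 1 * sg) * K * a ^+ 3.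
Proof.
move=> TT a0; have K0 := taylor2_ge0 TT.
have r0 : 0 <= a * sg by rewrite mulr_ge0.
have B0 : 0 <= B by exact: le_trans ler01 B1.
have [s0 s1 s2] := heat_step x TT r0.
rewrite (_ : _ - _ = (heat (a * sg) f x - f x - (a * sg) ^+ 2 / 2 * f2 x) +
  (a * h1 z) * (heat (a * sg) f1 x - f1 x) +
  (a ^+ 2 * h2 z) * (heat (a * sg) f2 x - f2 x)); last first.
  by rewrite /corrected exprMn sgE; move: (heat _ f x) (heat _ f1 x) (heat _ f2 x) => *; field.
apply: le_trans (ler_normD _ _) _; apply: le_trans (lerD (ler_normD _ _) (lexx _)) _.
have -> : (gauss_absmoment 3 * sg ^+ 3 + B * sg ^+ 2 + B * gauss_absmoment 1 * sg) * K * a ^+ 3 =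
  K * gauss_absmoment 3 * (a * sg) ^+ 3 + a * B * (K * (a * sg) ^+ 2) +
  a ^+ 2 * B * (K * gauss_absmoment 1 * (a * sg)).
  by move: (gauss_absmoment 3) (gauss_absmoment 1) => *; ring.
apply: lerD; first apply: lerD => //.
- rewrite normrM; apply: ler_pM => //.
  by rewrite normrM (ger0_norm a0) ler_wpM2l.
- rewrite normrM; apply: ler_pM => //.
  by rewrite normrM normrX (ger0_norm a0) ler_wpM2l ?exprn_ge0.
Qed.

Definition step_const :=
  3 * B ^+ 3 + (gauss_absmoment 3 * sg ^+ 3 + B * sg ^+ 2 + B * gauss_absmoment 1 * sg).

Lemma step_const_ge0 : 0 <= step_const.
Proof.
have B0 : 0 <= B by exact: le_trans ler01 B1.
by rewrite /step_const !(addr_ge0, mulr_ge0, exprn_ge0, gauss_absmoment_ge0).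
Qed.

(** The one-step errors add up, since each step of the chain is a contraction for
the uniform norm and the heat flow keeps the constant of the class. *)
Lemma iter_walk_op_corrected K f f1 f2 (a : R) n x z : taylor2 K f f1 f2 -> 0 <= a ->
  `|iter n (walk_op a) (corrected a f f1 f2) x z - corrected a (iter n (heat (a * sg)) f)
     (iter n (heat (a * sg)) f1) (iter n (heat (a * sg)) f2) x z|
  <= n%:R * (step_const * K * a ^+ 3).
Proof.
move=> TT a0; elim: n f f1 f2 TT x z => [|n IH] f f1 f2 TT x z /=.
  by rewrite subrr normr0 mul0r.
rewrite -!iterS !iterSr -natr1 mulrDl mul1r [leRHS]addrC.
set u := iter n _ _ x z; set w := corrected _ _ _ _ x z.
set v := iter n (walk_op a)
  (corrected a (heat (a * sg) f) (heat (a * sg) f1) (heat (a * sg) f2)) x z.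
rewrite (_ : u - w = (u - v) + (v - w)); last by rewrite addrA subrK.
apply: le_trans (ler_normD _ _) (lerD _ _).
  apply: iter_walk_op_dist => x' z'.
  have h1' := walk_op_corrected x' z' TT a0; have h2' := corrected_heat x' z' TT a0.
  move: h1' h2'; rewrite /step_const.
  set A := walk_op _ _ _ _; set C := (_ + _ * f2 x'); set D := corrected _ _ _ _ _ _.
  move=> h1' h2'; rewrite (_ : A - D = (A - C) - (D - C)); last by ring.
  apply: le_trans (ler_normB _ _) _; rewrite -mulrA (mulrDl _ _ (K * _)).
  apply: lerD; first by rewrite mulrA.
  by rewrite [leRHS]mulrA.
apply: IH; exact: heat_taylor2.
Qed.

Lemma corrected_near K f f1 f2 (a x : R) z : taylor2 K f f1 f2 -> 0 <= a <= 1 ->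
  `|corrected a f f1 f2 x z - f x| <= 2 * B * K * a.
Proof.
move=> TT /andP[a0 a1]; have [/(_ x)[_ b1 b2] _ _ _] := TT.
have K0 := taylor2_ge0 TT; have B0 : 0 <= B by exact: le_trans ler01 B1.
rewrite (_ : _ - _ = a * f1 x * h1 z + a ^+ 2 * f2 x * h2 z); last by rewrite /corrected; ring.
apply: le_trans (ler_normD _ _) _.
rewrite (_ : 2 * B * K * a = a * K * B + a * K * B); last by ring.
apply: lerD; rewrite !normrM; apply: ler_pM => //; apply: ler_pM => //.
  by rewrite ger0_norm.
by rewrite (ger0_norm a0) ler_piMl.
Qed.

Lemma iter_heat_taylor2 (K : R) f f1 f2 r n : taylor2 K f f1 f2 ->
  taylor2 K (iter n (heat r) f) (iter n (heat r) f1) (iter n (heat r) f2).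
Proof. by move=> TT; elim: n => //= n IH; exact: heat_taylor2. Qed.

Lemma iter_walk_op_heat K f f1 f2 (a : R) n x z : taylor2 K f f1 f2 -> 0 <= a <= 1 ->
  `|iter n (walk_op a) (fun x _ => f x) x z - iter n (heat (a * sg)) f x|
  <= n%:R * (step_const * K * a ^+ 3) + 4 * B * K * a.
Proof.
move=> TT a01; have /andP[a0 _] := a01.
have TTn := iter_heat_taylor2 (a * sg) n TT.
have e1 := iter_walk_op_corrected n x z TT a0.
have e2 := corrected_near x z TTn a01.
have e3 : `|iter n (walk_op a) (fun x _ => f x) x z - iter n (walk_op a) (corrected a f f1 f2) x z|
   <= 2 * B * K * a.
  by apply: iter_walk_op_dist => x' z'; rewrite distrC; exact: corrected_near.
apply: le_trans (ler_distD (corrected a (iter n (heat (a * sg)) f) (iter n (heat (a * sg)) f1)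
  (iter n (heat (a * sg)) f2) x z) _ _) _.
have := ler_distD (iter n (walk_op a) (corrected a f f1 f2) x z)
  (iter n (walk_op a) (fun x _ => f x) x z) (corrected a (iter n (heat (a * sg)) f)
  (iter n (heat (a * sg)) f1) (iter n (heat (a * sg)) f2) x z).
lra.
Qed.

Lemma markov_op_bound (w : T -> R) (W : R) z : (forall z', `|w z'| <= W) -> `|markov_op w z| <= W.
Proof.
move=> wW; have := @mean_dist w (fun=> 0) W z; rewrite mean_cst subr0; apply.
by move=> z'; rewrite subr0.
Qed.

(** During [k] steps the running sum moves by O(k a), so [f] factors out and only
the weight feels the chain. *)
Lemma iter_walk_op_weight K f f1 f2 (a W x : R) w k z : taylor2 K f f1 f2 -> 0 <= a ->
  a * B <= 1 -> (forall z, `|w z| <= W) ->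
  `|iter k (walk_op a) (fun x z => f x * w z) x z - f x * iter k markov_op w z|
   <= k%:R * (3 * K * B * W * a).
Proof.
move=> TT a0 aB; have K0 := taylor2_ge0 TT.
have B0 : 0 <= B by exact: le_trans ler01 B1.
elim: k w x z => [|k IH] w x z wW; first by rewrite subrr normr0 mul0r.
rewrite !iterSr -natr1 mulrDl mul1r [leRHS]addrC.
set u := iter k _ (walk_op _ _) x z; set t := f x * _.
set v := iter k (walk_op a) (fun x z => f x * markov_op w z) x z.
rewrite (_ : u - t = (u - v) + (v - t)); last by rewrite addrA subrK.
apply: le_trans (ler_normD _ _) (lerD _ _); last first.
  by apply: IH => z'; exact: markov_op_bound.
apply: iter_walk_op_dist => x' z'; rewrite /walk_op /markov_op mulr_sumr.
under [X in _ - X]eq_bigr do rewrite mulrCA.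
apply: mean_dist => y; rewrite -mulrBl normrM.
rewrite (_ : 3 * K * B * W * a = 3 * K * (a * B) * W); last by ring.
apply: ler_pM => //.
have yB : `|a * g y| <= a * B by rewrite normrM (ger0_norm a0) ler_wpM2l.
apply: le_trans (taylor2_lipschitz TT _ (le_trans yB aB)) _.
by rewrite ler_wpM2l// mulr_ge0.
Qed.

(** With (n + 1) a^2 = 1, the first n - k steps of the heat flow leave only the
variance of k + 1 steps, a small one, to reach [heat sg]. *)
Lemma iter_heat_missing K f f1 f2 (a x : R) k n : taylor2 K f f1 f2 -> 0 <= a <= 1 ->
  n.+1%:R * a ^+ 2 = 1 -> (k <= n)%N ->
  `|iter (n - k) (heat (a * sg)) f x - heat sg f x| <=
  K * (gauss_absmoment 3 * (Num.sqrt k.+1%:R * sg) ^+ 3 + (Num.sqrt k.+1%:R * sg) ^+ 2) * a.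
Proof.
move=> TT /andP[a0 a1] na kn; have K0 := taylor2_ge0 TT.
have r0 : 0 <= a * sg by rewrite mulr_ge0.
pose D := Num.sqrt k.+1%:R * sg; have D0 : 0 <= D by rewrite mulr_ge0.
have Da0 : 0 <= D * a by rewrite mulr_ge0.
have TTn := iter_heat_taylor2 (a * sg) (n - k) TT.
have -> : heat sg f = heat (D * a) (iter (n - k) (heat (a * sg)) f).
  rewrite (iter_heat _ TT)//; apply/funext => y.
  rewrite (heat_heat _ TT)//; last by rewrite mulr_ge0.
  congr (heat _ f y); rewrite /D !exprMn !sqr_sqrtr//.
  rewrite (_ : _ + _ = (k.+1%:R + (n - k)%:R) * a ^+ 2 * sg ^+ 2); last by ring.
  by rewrite -natrD addSn subnKC// na mul1r sqrtr_sqr ger0_norm.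
have [s0 _ _] := heat_step x TTn Da0.
have [/(_ x)[_ _ b2] _ _ _] := TTn.
move: s0 b2; move: (iter _ _ f) (iter _ _ f2) => u u2.
set X := heat _ _ _ => s0 b2; rewrite distrC.
rewrite (_ : X - u x = (X - u x - (D * a) ^+ 2 / 2 * u2 x) + (D * a) ^+ 2 / 2 * u2 x);
  last by rewrite subrK.
apply: le_trans (ler_normD _ _) _; rewrite mulrDr (mulrDl _ _ a); apply: lerD.
  have a3 : a ^+ 3 <= a by rewrite exprS ler_piMr// exprn_ile1.
  apply: le_trans s0 _; rewrite exprMn.
  rewrite (_ : _ * (D ^+ 3 * a ^+ 3) = K * (gauss_absmoment 3 * D ^+ 3) * a ^+ 3); last first.
    by move: (gauss_absmoment 3) => ?; ring.
  by rewrite ler_wpM2l// !mulr_ge0 ?gauss_absmoment_ge0 ?exprn_ge0.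
rewrite normrM ger0_norm ?divr_ge0 ?exprn_ge0// exprMn.
rewrite (_ : K * D ^+ 2 * a = D ^+ 2 * a * K); last by ring.
apply: ler_pM => //; first by rewrite divr_ge0 ?mulr_ge0 ?exprn_ge0.
rewrite -mulrA ler_wpM2l ?exprn_ge0//.
have : a ^+ 2 <= a by rewrite expr2 ler_piMl.
by have := exprn_ge0 2 a0; lra.
Qed.

(** The last [k] steps, with [k] fixed, average the endpoint weight [w] to its
stationary mean [m]; the other n - k steps are compared with the heat flow. *)
Theorem chain_clt (w : T -> R) (m : R) (f : R -> R) :
  (forall e, 0 < e -> exists k, forall z, `|iter k markov_op w z - m| <= e) ->
  smooth f -> forall e : R, 0 < e ->
  \forall n \near \oo, forall x z,
    `|iter n (walk_op (Num.sqrt n.+1%:R)^-1) (fun x z => f x * w z) x z - m * heat sg f x| <= e.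
Proof.
move=> mixw [K [f1 [f2 TT]]] e e0; have K0 := taylor2_ge0 TT.
have B0 : 0 < B by exact: lt_le_trans ltr01 B1.
have [k kw] : exists k, forall z, `|iter k markov_op w z - m| <= e / 2 / (K + 1).
  by apply: mixw; rewrite !divr_gt0// ltr_wpDl.
pose W : R := \sum_z `|w z|.
have wW z : `|w z| <= W by rewrite /W (bigD1 z)//= lerDl sumr_ge0.
(* The errors proportional to the step size add up to at most A a; the other half
   of e is for the weight. *)
pose A := k%:R * (3 * K * B * W) + `|m| * (step_const * K + 4 * B * K +
  K * (gauss_absmoment 3 * (Num.sqrt k.+1%:R * sg) ^+ 3 + (Num.sqrt k.+1%:R * sg) ^+ 2)).
have A0 : 0 <= A.
  have W0 : 0 <= W by rewrite sumr_ge0.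
  by rewrite /A !(addr_ge0, mulr_ge0, exprn_ge0, gauss_absmoment_ge0, step_const_ge0)// ltW.
have d0 : 0 < Num.min B^-1 (e / 2 / (A + 1)).
  by rewrite lt_min invr_gt0 B0 !divr_gt0// ltr_wpDl.
have /cvgrPdist_lt/(_ _ d0) acvd := @cvg_inv_sqrt R.
near=> n.
have : `|0 - (Num.sqrt n.+1%:R)^-1| < Num.min B^-1 (e / 2 / (A + 1)) by near: n.
have kn : (k <= n)%N by near: n; exact: nbhs_infty_ge.
move=> + x z; set a := (Num.sqrt _)^-1.
have a0 : 0 < a by rewrite invr_gt0 sqrtr_gt0.
rewrite sub0r normrN gtr0_norm// lt_min => /andP[aB aA].
have a1 : 0 <= a <= 1.
  by rewrite ltW//= invf_le1 ?sqrtr_gt0// -[leLHS]sqrtr1 ler_wsqrtr// ler1n.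
have na : n.+1%:R * a ^+ 2 = 1 by rewrite exprVn sqr_sqrtr// divff.
have aB1 : a * B <= 1 by rewrite -ler_pdivlMr// mul1r ltW.
have aA1 : a * (A + 1) <= e / 2 by rewrite -ler_pdivlMr ?ltr_wpDl// ltW.
have e1 : forall x z, `|iter k (walk_op a) (fun x z => f x * w z) x z - m * f x| <=
    k%:R * (3 * K * B * W) * a + e / 2 / (K + 1) * K.
  move=> x' z'; have := iter_walk_op_weight x' k z' TT (ltW a0) aB1 wW.
  have [/(_ x')[b _ _] _ _ _] := TT => h.
  rewrite (_ : _ - _ = (iter k (walk_op a) (fun x z => f x * w z) x' z' -
    f x' * iter k markov_op w z') + (iter k markov_op w z' - m) * f x'); last by ring.
  apply: le_trans (ler_normD _ _) (lerD _ _); first by rewrite -mulrA.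
  by rewrite normrM; apply: ler_pM.
have := iter_walk_op_dist a (n - k) e1 x z.
rewrite -iterD subnK// iter_walk_opZ.
have := iter_walk_op_heat (n - k) x z TT a1.
have := iter_heat_missing x TT a1 na kn.
move: (heat sg f x) (iter (n - k) _ f x) (iter (n - k) _ _ x z) (iter n _ _ x z) => u v t y.
move=> d1 d2 d3.
have nk : (n - k)%:R * (step_const * K * a ^+ 3) <= step_const * K * a.
  have : (n - k)%:R * a ^+ 2 <= 1.
    by rewrite -[leRHS]na ler_wpM2r ?sqr_ge0// ler_nat leqW// leq_subr.
  move=> /(ler_wpM2l (mulr_ge0 (mulr_ge0 step_const_ge0 K0) (ltW a0))); rewrite mulr1.
  by rewrite (_ : step_const * K * a * _ = (n - k)%:R * (step_const * K * a ^+ 3)); last by ring.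
have d4 : `|m * t - m * u| <= `|m| * (step_const * K + 4 * B * K +
  K * (gauss_absmoment 3 * (Num.sqrt k.+1%:R * sg) ^+ 3 + (Num.sqrt k.+1%:R * sg) ^+ 2)) * a.
  rewrite -mulrBr normrM -mulrA ler_wpM2l//.
  rewrite (_ : t - u = (t - v) + (v - u)); last by rewrite addrA subrK.
  apply: le_trans (ler_normD _ _) _; rewrite (mulrDl _ _ a); apply: lerD => //.
  by apply: le_trans d2 _; rewrite [leRHS]mulrDl lerD2r.
have d5 : e / 2 / (K + 1) * K <= e / 2.
  rewrite -mulrA mulrC ler_piMl ?divr_ge0 ?ltW//.
  by rewrite mulrC ltr_pdivrMr ?ltr_wpDl// mul1r ltrDl.
have -> : y - m * u = (y - m * t) + (m * t - m * u) by ring.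
apply: le_trans (ler_normD _ _) _.
have hA : A * a <= e / 2.
  by apply: le_trans aA1; rewrite mulrDr mulr1 mulrC lerDl ltW.
apply: le_trans (lerD d3 d4) _; rewrite addrAC -mulrDl -/A.
by rewrite [leRHS](splitr e); exact: lerD.
Unshelve. all: by end_near. Qed.

End Corrector.
End Chain.

(** * The digit automaton *)

Section Digits.
Variables (L : nat) (c G : nat -> nat).
Local Open Scope nat_scope.

(** State [j] means that the digits read since the last return to state 1 are
c_1, ..., c_{j-1}. *)
Fixpoint accepted (j : nat) (a : seq nat) : bool :=
  if a is x :: t then (x < c j) && accepted 1 t || [&& j < L, x == c j & accepted j.+1 t]
  else true.

(** A recursion on the first digit.  The values of the words that it counts fill
the interval [0, nb_accepted n j) without repetition. *)
Fixpoint nb_accepted (n j : nat) : nat :=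
  if n is m.+1 then c j * nb_accepted m 1 + (if j < L then nb_accepted m j.+1 else 0) else 1.

(** The accepted word of length [n] from state [j] with value [N].  Words with
first digit x < c_j fill consecutive blocks of length [nb_accepted m 1], and
those with first digit c_j come after these blocks. *)
Fixpoint digits_of_value (n j N : nat) : seq nat :=
  if n is m.+1 then
    if N < c j * nb_accepted m 1
    then N %/ nb_accepted m 1 :: digits_of_value m 1 (N %% nb_accepted m 1)
    else c j :: digits_of_value m j.+1 (N - c j * nb_accepted m 1)
  else [::].

Lemma size_digits_of_value n j N : size (digits_of_value n j N) = n.
Proof. by elim: n j N => //= n IH j N; case: ifP => _ /=; rewrite IH. Qed.

(** Split the words according to the length of their initial run
c_j, c_{j+1}, ... of maximal digits; the last summand is the word that consists
of such a run only. *)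
Lemma nb_acceptedE n j : 0 < j <= L -> nb_accepted n j =
  \sum_(0 <= i < minn n (L - j).+1) c (j + i) * nb_accepted (n - i.+1) 1 + (n <= L - j).
Proof.
elim: n j => [|n IH] j /andP[j0 jL] /=; first by rewrite min0n big_geq.
rewrite -[minn n.+1 _]/(minn n.+1 (L - j).+1) minnSS big_nat_recl// addn0 subn1/=.
rewrite -addnA; congr (_ + _); case: ltnP => jL'.
  rewrite IH; last by rewrite jL'.
  have -> : (L - j.+1).+1 = L - j by lia.
  congr (_ + _); last by lia.
  by apply: eq_big_nat => i _; rewrite addSnnS.
have -> : L - j = 0 by lia.
by rewrite minn0 big_geq.
Qed.

Hypothesis hG : is_PLR L c G.
Hypothesis L0 : 0 < L.

Lemma nb_accepted_G n : nb_accepted n 1 = G n.+1.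
Proof.
have [G1 Gs Gl] := hG.
elim/ltn_ind: n => n IH; rewrite nb_acceptedE ?L0// subn1 (ltn_predK L0).
have E m : m <= n -> \sum_(0 <= i < m) c (1 + i) * nb_accepted (n - i.+1) 1 =
   \sum_(1 <= j < m.+1) c j * G (n.+1 - j).
  move=> mn; rewrite big_add1; apply: eq_big_nat => i /andP[_ im].
  rewrite add1n IH; last by lia.
  by congr (_ * G _); lia.
have [nL|nL] := ltnP n L.
  rewrite E//.
  have [->|n0] := posnP n; first by rewrite big_geq.
  by rewrite Gs ?n0//; congr (_ + _); lia.
rewrite E// Gl//.
by rewrite (_ : (n <= L.-1) = false) ?addn0//; lia.
Qed.

Hypothesis c1 : 0 < c 1.

Lemma PLR_gt0 n : 0 < G n.+1.
Proof.
rewrite -nb_accepted_G; elim: n => //= n IH.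
by rewrite addn_gt0 muln_gt0 c1 IH.
Qed.

Lemma PLR_homo m n : m <= n -> G m.+1 <= G n.+1.
Proof.
move=> /subnKC <-; elim: (n - m) => [|i IH]; first by rewrite addn0.
apply: leq_trans IH _; rewrite addnS -!nb_accepted_G /=.
by apply: leq_trans (leq_addr _ _); rewrite leq_pmull.
Qed.

Lemma digits_value_nil : digits_value G [::] = 0.
Proof. by rewrite /digits_value big_geq. Qed.

Lemma digits_value_cons x t :
  digits_value G (x :: t) = x * G (size t).+1 + digits_value G t.
Proof.
rewrite /digits_value /= big_nat_recl// subn1/=; congr (_ + _).
by apply: eq_big_nat => -[|i] // _; rewrite /= subSS.
Qed.

Lemma accepted_value_lt j a : accepted j a -> digits_value G a < nb_accepted (size a) j.
Proof.
elim: a j => [|x t IH] j /=; first by rewrite digits_value_nil.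
rewrite digits_value_cons -nb_accepted_G; case/orP => [/andP[xc /IH v]|/and3P[jL /eqP-> /IH v]].
  apply: leq_trans (leq_addr _ _).
  by apply: leq_trans (leq_mul xc (leqnn _)); rewrite mulSn addnC -addSn leq_add2r.
by rewrite jL -addnS leq_add2l.
Qed.

(** A word with a smaller first digit x < y has a value below
(x + 1) G <= y G, hence equal values force equal first digits. *)
Lemma accepted_inj j a b : accepted j a -> accepted j b -> size a = size b ->
  digits_value G a = digits_value G b -> a = b.
Proof.
have hd j' x t y u : accepted j' (x :: t) -> accepted j' (y :: u) -> size t = size u ->
    digits_value G (x :: t) = digits_value G (y :: u) -> y <= x.
  move=> /= ax ay tu; rewrite !digits_value_cons -tu leqNgt => E; apply/negP => xy.
  case/orP: ax => [/andP[xc /accepted_value_lt]|/and3P[_ /eqP xc _]].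
    rewrite nb_accepted_G => v.
    have : x.+1 * G (size t).+1 <= y * G (size t).+1 by rewrite leq_mul2r xy orbT.
    by rewrite mulSn; lia.
  by case/orP: ay => [/andP[yc _]|/and3P[_ /eqP yc _]]; lia.
elim: a j b => [|x t IH] j [|y u]// ax ay [tu] E.
have xy : x = y by apply/eqP; rewrite eqn_leq (hd _ _ _ _ _ ay ax) ?(hd _ _ _ _ _ ax ay).
subst y; congr (_ :: _); move: E; rewrite !digits_value_cons tu => /addnI E.
case/orP: ax => [/andP[xc at']|/and3P[_ /eqP xc at']];
 case/orP: ay => [/andP[yc au]|/and3P[_ /eqP yc au]].
- exact: (IH _ _ at' au).
- by lia.
- by lia.
- exact: (IH _ _ at' au).
Qed.

Lemma digits_of_valueP n j N : N < nb_accepted n j ->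
  accepted j (digits_of_value n j N) /\ digits_value G (digits_of_value n j N) = N.
Proof.
elim: n j N => [|n IH] j N /=; first by rewrite digits_value_nil; case: N.
have w0 : 0 < nb_accepted n 1 by rewrite nb_accepted_G PLR_gt0.
move=> Nw; case: (ltnP N (c j * nb_accepted n 1)) => Nc.
  have [a1 v1] := IH 1 (N %% nb_accepted n 1) (ltn_pmod _ w0).
  rewrite digits_value_cons size_digits_of_value -nb_accepted_G v1 -divn_eq /= a1 andbT ltn_divLR//.
  by rewrite Nc.
have jL : j < L by move: Nw; case: (ltnP j L) => // _; rewrite addn0 ltnNge Nc.
rewrite jL in Nw; have NW : N - c j * nb_accepted n 1 < nb_accepted n j.+1 by lia.
have [a1 v1] := IH j.+1 _ NW.
rewrite digits_value_cons size_digits_of_value -nb_accepted_G v1 subnKC//=.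
by rewrite jL eqxx a1 /= orbT.
Qed.

Lemma accepted_prefix s b : 0 < s -> s <= L -> accepted s b ->
  accepted 1 ([seq c i | i <- iota 1 s.-1] ++ b).
Proof.
move=> s0 sL ab.
have H m j : j + m = s -> accepted j ([seq c i | i <- iota j m] ++ b).
  elim: m j => [|m IH] j jm /=; first by rewrite addn0 in jm; rewrite jm.
  by rewrite IH ?addSnnS// eqxx (_ : j < L) ?orbT//; lia.
by apply: H; lia.
Qed.

Lemma accepted_zeros l t : accepted 1 (nseq l 0 ++ t) = accepted 1 t.
Proof. by elim: l => //= l ->; rewrite c1 /=; case: (accepted 1 t) => //=; lia. Qed.

(** In case (i) the word follows the maximal digits; in case (ii) the digit below
c_s leads back to state 1, where zeros loop because 0 < c_1. *)
Lemma legal_accepted a : legal L c a -> accepted 1 a.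
Proof.
elim=> {a} [a /andP[a0 aL] _ aE|s d l t /andP[s0 sL] dc _ IH _].
  have H m j b : j + m = (size a).+1 -> 0 < j -> size b = m ->
      (forall i, i < m -> nth 0 b i = c (j + i)) -> accepted j b.
    elim: m j b => [|m IH] j [|x b]//= jm j0 [bm] bE.
    have -> : x = c j by have := bE 0 isT; rewrite addn0.
    have jL : j < L by lia.
    have ab : accepted j.+1 b.
      apply: IH => //; first by rewrite addSnnS.
      by move=> i im; have := bE i.+1 im; rewrite /= addSnnS.
    by rewrite eqxx jL ab orbT.
  by apply: (H (size a) 1).
apply: accepted_prefix => //=; rewrite dc accepted_zeros.
by case: t IH => [//|x t] -> .
Qed.

Lemma legal_head a : legal L c a -> 0 < head 0 a.
Proof. by case. Qed.

Lemma accepted_shape j a : 0 < j <= L -> accepted j a ->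
  (a = [seq c i | i <- iota j (size a)] /\ j + size a <= L) \/
  exists s d t, [/\ j <= s <= L, d < c s, accepted 1 t
    & a = [seq c i | i <- iota j (s - j)] ++ d :: t].
Proof.
elim: a j => [|x t IH] j /andP[j0 jL] /=; first by left; rewrite addn0.
case/orP => [/andP[xc at']|/and3P[jL' /eqP-> /(IH j.+1)]].
  by right; exists j, x, t; rewrite leqnn jL subnn.
rewrite jL' => /(_ isT)[[-> sz]|[s [d [t' [/andP[js sL] dc at' ->]]]]]; [left|right].
  by split; [rewrite size_map size_iota|rewrite addnS -addSn].
exists s, d, t'; split => //; first by rewrite (ltnW js).
by rewrite -(subnSK js).
Qed.

Lemma zeros_split (t : seq nat) :
  exists l t', t = nseq l 0 ++ t' /\ (t' <> [::] -> 0 < head 0 t').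
Proof.
elim: t => [|[|x] t [l [t' [-> h]]]]; first by exists 0, [::].
  by exists l.+1, t'.
by exists 0, (x.+1 :: nseq l 0 ++ t').
Qed.

(** The first digit that is not maximal is the a_s of case (ii), and the zeros
that follow it are stripped before recursion. *)
Lemma accepted_legal a : accepted 1 a -> 0 < head 0 a -> legal L c a.
Proof.
have [n] := ubnP (size a); elim: n a => // n IH a an aa ha.
have a0 : 0 < size a by case: a ha {an aa}.
have [|[aE sz]|[s [d [t [/andP[s1 sL] dc at' aE]]]]] := accepted_shape _ aa; first by rewrite L0.
  apply: legal_i => //; first by rewrite a0.
  by move=> i ia; rewrite {1}aE (nth_map 0) ?size_iota// nth_iota// add1n.
have [l [t' [tE ht']]] := zeros_split t.
rewrite aE subn1 tE; apply: legal_ii; rewrite ?s1//.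
- move=> t'0; apply: IH => //; last exact: ht'.
  + by move: an; rewrite aE tE !size_cat /= size_cat; lia.
  + by move: at'; rewrite tE accepted_zeros.
- by rewrite -tE -(subn1 s) -aE.
Qed.

Lemma head_value a : a <> [::] -> 0 < head 0 a -> G (size a) <= digits_value G a.
Proof.
case: a => // x t _ /= x0; rewrite digits_value_cons.
by apply: leq_trans (leq_addr _ _); rewrite leq_pmull.
Qed.

(** The greedy word qualifies, and any other legal decomposition of [N] has the
same length, since G is nondecreasing, hence the same digits. *)
Lemma legal_decompositionE n N : G n.+1 <= N < G n.+2 ->
  legal_decomposition L c G N = digits_of_value n.+1 1 N.
Proof.
move=> /andP[nN Nn].
have Nw : N < nb_accepted n.+1 1 by rewrite nb_accepted_G.
have [ad vd] := digits_of_valueP Nw.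
have hd : 0 < head 0 (digits_of_value n.+1 1 N).
  rewrite [digits_of_value _ _ _]/=; case: ifP => _ //=.
  by rewrite divn_gt0 nb_accepted_G ?PLR_gt0.
have ld := accepted_legal ad hd.
rewrite /legal_decomposition; case: xgetP => [a _ [la vN]|/(_ (digits_of_value n.+1 1 N))];
  last first.
  by case; split => //; rewrite vd.
have aa := legal_accepted la; have ha := legal_head la.
have a0 : a <> [::] by move=> a0; move: ha; rewrite a0.
have va := accepted_value_lt aa; rewrite nb_accepted_G -vN in va.
have ga := head_value a0 ha; rewrite -vN in ga.
apply: (accepted_inj aa ad); last by rewrite vd.
rewrite size_digits_of_value; apply/eqP; rewrite eqn_leq; apply/andP; split; rewrite leqNgt;
  apply/negP => h.
  have : G n.+2 <= G (size a) by rewrite -(ltn_predK h); apply: PLR_homo; lia.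
  by rewrite leqNgt (leq_ltn_trans ga Nn).
have : G (size a).+1 <= G n.+1 by apply: PLR_homo; rewrite -ltnS.
by rewrite leqNgt (leq_ltn_trans nN va).
Qed.

Definition nb_nonzero (a : seq nat) : nat := count (fun d => d != 0) a.

Section Sums.
Context {R : realType}.
Local Open Scope ring_scope.

(** Summing over the values N < nb_accepted n j is summing over the accepted words
of length [n] from state [j]; the offset [k] counts the nonzero digits that were
already read. *)
Definition value_sum (f : nat -> R) (n j k : nat) : R :=
  \sum_(0 <= N < nb_accepted n j) f (k + nb_nonzero (digits_of_value n j N))%N.

Lemma sum_blocks (H : nat -> nat -> R) (w k : nat) : (0 < w)%N ->
  \sum_(0 <= N < k * w) H (N %/ w)%N (N %% w)%N =
  \sum_(0 <= x < k) \sum_(0 <= N < w) H x N.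
Proof.
move=> w0; elim: k => [|k IH]; first by rewrite mul0n !big_geq.
rewrite mulSn addnC (@big_cat_nat _ _ _ (k * w)) ?leq_addr//= IH big_nat_recr//=.
congr (_ + _); rewrite -{1}[(k * w)%N]add0n big_addn addKn.
apply: eq_big_nat => N /andP[_ Nw].
by rewrite addnC divnMDl// modnMDl divn_small// modn_small// addn0.
Qed.

Lemma value_sumS f n j k : value_sum f n.+1 j k =
  \sum_(0 <= x < c j) value_sum f n 1 (k + (0 < x))
  + (if (j < L)%N then value_sum f n j.+1 (k + (0 < c j)) else 0).
Proof.
have w0 : (0 < nb_accepted n 1)%N by rewrite nb_accepted_G PLR_gt0.
rewrite /value_sum [nb_accepted n.+1 j]/= (@big_cat_nat _ _ _ (c j * nb_accepted n 1)) ?leq_addr//=.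
congr (_ + _).
  rewrite -(sum_blocks (fun x N => f (k + (0 < x) + nb_nonzero (digits_of_value n 1 N))%N))//.
  apply: eq_big_nat => N /andP[_ ->]; rewrite /nb_nonzero/= lt0n.
  by rewrite addnA.
rewrite -{1}[(c j * _)%N]add0n big_addn addKn; case: (ltnP j L) => jL; last by rewrite big_geq.
apply: eq_big_nat => N _.
by rewrite ltnNge leq_addl/= addnK /nb_nonzero/= lt0n addnA.
Qed.

(** Words of length n + 1 with first digit 0 have the values below G_{n+1} and the
nonzero digits of the word of length n with the same value; removing them from
all words of length n + 1 leaves those that decompose the integers in
[G_{n+1}, G_{n+2}). *)
Lemma sum_nb_nonzero_digits (f : nat -> R) n :
  \sum_(0 <= i < G n.+2 - G n.+1) f (nb_nonzero_digits L c G (G n.+1 + i)) =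
  \sum_(1 <= x < c 1) value_sum f n 1 1
  + (if (1 < L)%N then value_sum f n 2 1 else 0).
Proof.
have E : \sum_(0 <= i < G n.+2 - G n.+1) f (nb_nonzero_digits L c G (G n.+1 + i)) =
   value_sum f n.+1 1 0 - value_sum f n 1 0.
  apply/eqP; rewrite eq_sym subr_eq eq_sym /value_sum nb_accepted_G nb_accepted_G.
  rewrite [X in _ == X](@big_cat_nat _ _ _ (G n.+1)) ?PLR_homo// addrC; apply/eqP.
  congr (_ + _).
    apply: eq_big_nat => N /andP[_ NG].
    have Nw : (N < nb_accepted n 1)%N by rewrite nb_accepted_G.
    have cw : (nb_accepted n 1 <= c 1 * nb_accepted n 1)%N by rewrite leq_pmull.
    by rewrite /= (leq_trans Nw cw) divn_small// modn_small.
  rewrite -{3}[G n.+1]add0n big_addn; apply: eq_big_nat => i /andP[_ iG].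
  rewrite /nb_nonzero_digits (@legal_decompositionE n) 1?addnC//.
  by rewrite leq_addl/= addnC -ltn_subRL.
rewrite E value_sumS (big_ltn c1)/= !addn0 -addrA addrC addrA addrNK.
rewrite c1 addrC; congr (_ + _).
by apply: eq_big_nat => x /andP[x0 _]; rewrite x0.
Qed.

Lemma leq_cmax j : (0 < j <= L)%N -> (c j <= cmax L c)%N.
Proof.
move=> /andP[j0 jL]; rewrite /cmax (bigD1_seq j) ?iota_uniq//=; first exact: leq_maxl.
by rewrite mem_index_iota j0.
Qed.

Lemma sum_LL_val (F : 'I_(cmax L c).+1 * 'I_L * 'I_L -> R)
    (P : pred ('I_(cmax L c).+1 * 'I_L * 'I_L)) :
  \sum_(z : LL L c | P (val z)) F (val z) = \sum_(z | in_LL z && P z) F z.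
Proof.
rewrite [RHS](reindex_omap (val : LL L c -> _) insub)/=; last first.
  by move=> z /andP[zL _]; rewrite insubT.
by apply: eq_bigl => z; rewrite valK eqxx andbT (valP z).
Qed.

(** The elements of [LL] with second coordinate j are the transitions of the
automaton from state j. *)
Lemma sum_LL (H : nat -> nat -> R) (j : 'I_L) :
  \sum_(z : LL L c | LLj z == j) H (LLx z) (LLj' z).+1 =
  \sum_(0 <= x < c j.+1) H x 1%N + (if (j.+1 < L)%N then H (c j.+1) j.+2 else 0).
Proof.
have cj : (c j.+1 <= cmax L c)%N by apply: leq_cmax; rewrite ltn_ord.
rewrite (sum_LL_val (fun z => H (val z.1.1) (val z.2).+1) (fun z => z.1.2 == j)).
pose F x := \sum_(j' : 'I_L | ((x < c j.+1) && (j'.+1 == 1) ||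
   [&& j.+1 < L, x == c j.+1 & j'.+1 == j.+2])%N) H x j'.+1.
transitivity (\sum_(x < (cmax L c).+1) F x).
  rewrite pair_big_dep /=.
  rewrite (reindex_onto (fun u : 'I_(cmax L c).+1 * 'I_L => (u.1, j, u.2))
     (fun z => (z.1.1, z.2)))/=; last first.
    by move=> [[x i] j'] /= /andP[_ /eqP->].
  by apply: eq_bigl => -[x j'] /=; rewrite !eqxx !andbT.
have j0 : (0 < L)%N by [].
have F1 x : (x < c j.+1)%N -> F x = H x 1%N.
  move=> xc; rewrite /F (big_pred1 (Ordinal L0))// => j' /=.
  by rewrite xc (_ : (x == c j.+1) = false) ?andbF ?orbF -?val_eqE//=; lia.
have F2 : F (c j.+1) = if (j.+1 < L)%N then H (c j.+1) j.+2 else 0.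
  rewrite /F ltnn eqxx/=; case: ifP => jL; last by rewrite big_pred0.
  by rewrite (big_pred1 (Ordinal jL))// => j'; rewrite -val_eqE /= eqSS.
have F3 x : (c j.+1 < x)%N -> F x = 0.
  move=> xc; rewrite /F big_pred0// => j'.
  by rewrite ltnNge (ltnW xc)/= gtn_eqF// andbF.
rewrite -(big_mkord predT F) (@big_cat_nat _ _ _ (c j.+1).+1)//=.
rewrite [X in _ + X]big1_seq ?addr0; last first.
  by move=> x; rewrite mem_index_iota => /andP[_ /andP[cx _]]; exact: F3.
rewrite big_nat_recr//= F2; congr (_ + _).
by apply: eq_big_nat => x /andP[_ xc]; exact: F1.
Qed.

Lemma value_sum_LL f n k (z : LL L c) : value_sum f n.+1 (LLj' z).+1 k =
  \sum_(z' : LL L c | LLj z' == LLj' z) value_sum f n (LLj' z').+1 (k + (0 < LLx z')).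
Proof.
by rewrite (sum_LL (fun x j => value_sum f n j (k + (0 < x))%N)) value_sumS.
Qed.

(** Transitions that read the first digit of an integer: out of state 1, which is
the ordinal 0, with a nonzero digit. *)
Definition leading (z : LL L c) : bool := (val (LLj z) == 0%N) && (0 < LLx z)%N.

Lemma sum_nb_nonzero_leading (f : nat -> R) n :
  \sum_(0 <= i < G n.+2 - G n.+1) f (nb_nonzero_digits L c G (G n.+1 + i)) =
  \sum_(z : LL L c | leading z) value_sum f n (LLj' z).+1 1.
Proof.
rewrite sum_nb_nonzero_digits big_mkcondr/=; apply/esym.
have := sum_LL (fun x j => if (0 < x)%N then value_sum f n j 1 else 0) (Ordinal L0).
rewrite /= c1 (big_ltn c1)/= add0r => E; apply: etrans (etrans E _).
  by apply: eq_bigl => z; rewrite -val_eqE.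
by congr (_ + _); apply: eq_big_nat => -[|x].
Qed.

Lemma exists_leading : (L, c 1) <> (1%N, 1%N) -> exists z : LL L c, leading z.
Proof.
move=> Lc1.
have cj : (c 1 <= cmax L c)%N by apply: leq_cmax.
have [c2|c2] := ltnP 1 (c 1).
  have x1 : (1 < (cmax L c).+1)%N by lia.
  have zP : in_LL ((Ordinal x1, Ordinal L0, Ordinal L0) : 'I_(cmax L c).+1 * 'I_L * 'I_L).
    by rewrite /in_LL /= c2.
  by exists (exist (fun z => is_true (in_LL z)) _ zP).
have c1E : c 1 = 1%N by lia.
have L1 : (1 < L)%N.
  by rewrite ltn_neqAle eq_sym L0 andbT; apply/eqP => LE; apply: Lc1; rewrite c1E LE.
have x1 : (1 < (cmax L c).+1)%N by lia.
have zP : in_LL ((Ordinal x1, Ordinal L0, Ordinal L1) : 'I_(cmax L c).+1 * 'I_L * 'I_L).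
  by rewrite /in_LL /= c1E L1.
by exists (exist (fun z => is_true (in_LL z)) _ zP).
Qed.
End Sums.
End Digits.

(** * The uniform measure and the chain of the automaton *)

Section Uniform.
Context {R : realType}.
Variable G : nat -> nat.

Lemma ge0_integral_Q_unif n (u : nat -> \bar R) : (forall t, (0 <= u t)%E) ->
  (\int[Q_unif R G n]_t u t =
   ((G n.+2 - G n.+1)%:R^-1)%:E * \sum_(i < G n.+2 - G n.+1) u (G n.+1 + i)%N)%E.
Proof.
move=> u0; rewrite /Q_unif ge0_integral_mscale//; congr (_ * _)%E.
rewrite ge0_integral_measure_sum//; apply: eq_bigr => i _.
by rewrite integral_dirac// diracT mul1e.
Qed.

(** Split [h] into positive and negative parts, for which the integral against a
finite sum of point masses is additive. *)
Lemma Rintegral_Q_unif n (h : nat -> R) :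
  \int[Q_unif R G n]_t h t = sample_mean (G n.+2 - G n.+1) (fun i => h (G n.+1 + i)%N) id.
Proof.
rewrite /Rintegral integralE !ge0_integral_Q_unif//.
have E (u : nat -> R) (v : nat -> \bar R) : (forall t, v t = (u t)%:E) ->
    (((G n.+2 - G n.+1)%:R^-1)%:E * \sum_(i < G n.+2 - G n.+1) v (G n.+1 + i)%N)%E =
    (sample_mean (G n.+2 - G n.+1) (fun i => u (G n.+1 + i)%N) id)%:E.
  by move=> vE; rewrite /sample_mean EFinM -sumEFin; congr (_ * _)%E; apply: eq_bigr.
rewrite (E (fun t => Num.max (h t) 0)); last by move=> t; rewrite funeposE -EFin_max.
rewrite (E (fun t => Num.max (- h t) 0)); last by move=> t; rewrite funenegE -EFinN -EFin_max.
rewrite -EFinB /= /sample_mean -mulrBr -sumrB; congr (_ * _); apply: eq_bigr => i _.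
rewrite /=; case: (leP 0 (h (G n.+1 + i)%N)) => h0.
  by rewrite max_r ?subr0// oppr_le0.
by rewrite max_l ?sub0r ?opprK// oppr_ge0 ltW.
Qed.

Lemma Q_unif_set n (S : set nat) : (Q_unif R G n S =
  (sample_mean (G n.+2 - G n.+1) (fun i => \1_S (G n.+1 + i)%N) id)%:E)%E.
Proof.
rewrite /Q_unif /mscale/= /msum /sample_mean EFinM -sumEFin; congr (_ * _)%E.
Qed.

End Uniform.

Section Automaton.
Context {R : realType}.
Variables (L : nat) (c G : nat -> nat).
Hypothesis hc : PLR_coef L c.

Local Notation T := 'I_#|LL L c|.
Local Notation st i := (enum_val (i : T) : LL L c).
Local Notation A := (P_LL R L c).
Definition composable (z z' : LL L c) : bool := LLj' z == LLj z'.
Definition P_scale : R := ((cmax L c).+1 * L)%:R.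

Lemma L_gt0 : (0 < L)%N. Proof. by case: hc. Qed.
Lemma c1_gt0 : (0 < c 1)%N. Proof. by case: hc => _; rewrite muln_gt0 => /andP[]. Qed.
Lemma cL_gt0 : (0 < c L)%N. Proof. by case: hc => _; rewrite muln_gt0 => /andP[]. Qed.

Lemma P_scale_gt0 : 0 < P_scale.
Proof. by rewrite ltr0n muln_gt0 L_gt0. Qed.

Lemma P_LL_E i j : A i j = if composable (st i) (st j) then P_scale^-1 else 0.
Proof. by rewrite mxE. Qed.

(** In state j the digit 0 is smaller than c_j, or equal to it; in the latter
case j < L because c_L > 0. *)
Lemma next_zero (j : 'I_L) : exists2 z : LL L c, LLj z = j &
  (val (LLj' z) = 0%N) \/ (val (LLj' z) = j.+1).
Proof.
have x0 : (0 < (cmax L c).+1)%N by [].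
have [cj|cj] := posnP (c j.+1).
  have jL : (j.+1 < L)%N.
    rewrite ltn_neqAle ltn_ord andbT; apply/eqP => jL.
    by have := cL_gt0; rewrite -jL cj.
  have zP : in_LL ((Ordinal x0, j, Ordinal jL) : 'I_(cmax L c).+1 * 'I_L * 'I_L).
    by rewrite /in_LL /= cj jL !eqxx orbT.
  by exists (exist (fun z => is_true (in_LL z)) _ zP); last right.
have zP : in_LL ((Ordinal x0, j, Ordinal L_gt0) : 'I_(cmax L c).+1 * 'I_L * 'I_L).
  by rewrite /in_LL /= cj.
by exists (exist (fun z => is_true (in_LL z)) _ zP); last left.
Qed.

Lemma zero_state : exists z : LL L c, val (LLj z) = 0%N /\ val (LLj' z) = 0%N.
Proof.
have x0 : (0 < (cmax L c).+1)%N by [].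
have zP : in_LL ((Ordinal x0, Ordinal L_gt0, Ordinal L_gt0) : 'I_(cmax L c).+1 * 'I_L * 'I_L).
  by rewrite /in_LL /= c1_gt0.
by exists (exist (fun z => is_true (in_LL z)) _ zP).
Qed.

Section Perron.
Variables (lambda : R) (nu : 'rV[R]_#|LL L c|) (phi : 'cV[R]_#|LL L c|).
Hypothesis nuA : nu *m A = lambda *: nu.
Hypothesis Aphi : A *m phi = lambda *: phi.
Hypothesis nu0 : forall i, 0 < nu 0 i.
Hypothesis phi0 : forall i, 0 < phi i 0.
Hypothesis nuphi : \sum_i nu 0 i * phi i 0 = 1.

Definition Qchain (i j : T) : R := doob_transform A lambda phi i j.
Definition pichain (i : T) : R := pi_Q nu phi 0 i.

Lemma QchainE i j : Qchain i j = (lambda * phi i 0)^-1 * A i j * phi j 0.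
Proof. by rewrite /Qchain mxE. Qed.

Lemma pichainE i : pichain i = nu 0 i * phi i 0.
Proof. by rewrite /pichain mxE. Qed.

Lemma P_LL_ge0 i j : 0 <= A i j.
Proof. by rewrite P_LL_E; case: ifP => // _; rewrite invr_ge0 ltW// P_scale_gt0. Qed.

Lemma lambda_gt0 : 0 < lambda.
Proof.
have [z0 [j0 j0']] := zero_state.
pose i := enum_rank z0.
have := congr1 (fun M : 'cV_ _ => M i 0) Aphi; rewrite !mxE => E.
have : 0 < lambda * phi i 0.
  rewrite -E (bigD1 i)//= ltr_wpDr//.
    by apply: sumr_ge0 => j _; rewrite mulr_ge0 ?P_LL_ge0// ltW.
  rewrite mulr_gt0// P_LL_E /composable !enum_rankK (_ : LLj' z0 == LLj z0).
    by rewrite invr_gt0 P_scale_gt0.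
  by apply/eqP/val_inj; rewrite j0 j0'.
by rewrite pmulr_lgt0.
Qed.

Lemma Qchain_ge0 i j : 0 <= Qchain i j.
Proof.
by rewrite QchainE !mulr_ge0 ?P_LL_ge0 ?invr_ge0 ?mulr_ge0// ltW ?lambda_gt0.
Qed.

Lemma Qchain_sum i : \sum_j Qchain i j = 1.
Proof.
under eq_bigr do rewrite QchainE -mulrA.
have := congr1 (fun M : 'cV_ _ => M i 0) Aphi; rewrite !mxE => E.
by rewrite -mulr_sumr E mulVf// mulf_neq0 ?gt_eqF ?lambda_gt0.
Qed.

Lemma pichain_ge0 i : 0 <= pichain i.
Proof. by rewrite pichainE mulr_ge0// ltW. Qed.

Lemma pichain_sum : \sum_i pichain i = 1.
Proof. by rewrite -nuphi; apply: eq_bigr => i _; rewrite pichainE. Qed.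

Lemma pichain_stationary j : \sum_i pichain i * Qchain i j = pichain j.
Proof.
have := congr1 (fun M : 'rV_ _ => M 0 j) nuA; rewrite !mxE => E.
have l0 : lambda != 0 by rewrite gt_eqF ?lambda_gt0.
rewrite pichainE -[nu 0 j]mul1r -(mulVf l0) -(mulrA lambda^-1) -E !(mulr_sumr, mulr_suml).
apply: eq_bigr => i _; rewrite pichainE QchainE.
have p0 : phi i 0 != 0 by rewrite gt_eqF.
by field; rewrite ?l0 ?p0.
Qed.

Lemma Qchain_gt0 i j : composable (st i) (st j) -> 0 < Qchain i j.
Proof.
move=> ij; rewrite QchainE P_LL_E ij.
by rewrite !mulr_gt0 ?invr_gt0 ?mulr_gt0 ?P_scale_gt0 ?lambda_gt0.
Qed.

(** Reading zeros increases the state by 1 until it returns to state 1, after at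
most L steps, and remains there from then on; waiting in state 1 makes the
number of steps the same for all starting points. *)
Lemma hits_all : exists i0 k, forall i, hits Qchain i0 k i.
Proof.
have [z0 [j0 j0']] := zero_state; pose i0 := enum_rank z0.
have st0 : st i0 = z0 by exact: enum_rankK.
have h1 n i : val (LLj' (st i)) = 0%N -> hits Qchain i0 n.+1 i.
  have a (i' : T) : val (LLj' (st i')) = 0%N -> 0 < Qchain i' i0.
    by move=> i'0; apply: Qchain_gt0; rewrite /composable st0; apply/eqP/val_inj; rewrite j0 i'0.
  elim: n i => [|n IH] i ij; apply: (hitsS Qchain_ge0 (a i ij)); first exact: hits0.
  by apply: IH; rewrite st0.
have h2 d i n : (L - LLj' (st i) <= d)%N -> hits Qchain i0 (d + n.+1) i.
  elim: d i n => [|d IH] i n; first by rewrite leqn0 subn_eq0 leqNgt ltn_ord.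
  have [z zj zj'] := next_zero (LLj' (st i)) => Ld.
  have stz : st (enum_rank z) = z by exact: enum_rankK.
  have a : 0 < Qchain i (enum_rank z) by apply: Qchain_gt0; rewrite /composable stz zj.
  rewrite addSn; apply: (hitsS Qchain_ge0 a).
  case: zj' => zj'; first by rewrite addnS; apply: h1; rewrite stz.
  by apply: IH; rewrite stz zj'; move: Ld; rewrite !leq_subLR addSnnS.
exists i0, (L + 1)%N => i; apply: h2; exact: leq_subr.
Qed.

Variable Qs : 'M[R]_#|LL L c|.
Hypothesis hQs : is_Qsharp (doob_transform A lambda phi) (pi_Q nu phi) Qs.

Local Notation p := (pi_Q nu phi).
Definition g_centered : 'cV[R]_#|LL L c| := Defs.center p (g_pos R L c).
Definition gtilde (i : T) : R := g_centered i 0.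
Definition Qsharp_g (i : T) : R := (Qs *m g_centered) i 0.

Lemma expectE (h : 'cV[R]_#|LL L c|) : expect p h = stat_mean pichain (fun i => h i 0).
Proof. by []. Qed.

Lemma stat_mean_affine (b d : R) (u : T -> R) :
  stat_mean pichain (fun i => b + d * u i) = b + d * stat_mean pichain u.
Proof.
rewrite /stat_mean mulr_sumr -[b in RHS]mul1r -pichain_sum mulr_suml -big_split/=.
by apply: eq_bigr => i _; ring.
Qed.

Lemma expect_center : expect p g_centered = 0.
Proof.
rewrite expectE.
transitivity (stat_mean pichain (fun i => - expect p (g_pos R L c) + 1 * g_pos R L c i 0)).
  by apply: eq_bigr => i _; rewrite !mxE mul1r addrC.
by rewrite stat_mean_affine mul1r -expectE addNr.
Qed.

(** [Qs] solves the Poisson equation, by definition of the inverse of I - Q. *)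
Lemma poisson (h : 'cV[R]_#|LL L c|) : expect p h = 0 ->
  forall i, (Qs *m h) i 0 = h i 0 + markov_op Qchain (fun j => (Qs *m h) j 0) i.
Proof.
move=> h0 i; have [_ /(_ h h0)[_ + _]] := hQs.
rewrite mulmxBl mul1mx => /(congr1 (fun M : 'cV_ _ => M i 0)) E.
apply/eqP; rewrite -subr_eq -E; apply/eqP.
move: (Qs *m h) => H; rewrite [in RHS]mxE; congr (_ + _).
by rewrite [in RHS]mxE; congr (- _); rewrite [in RHS]mxE.
Qed.

(** This is also Q (Qs gtilde). *)
Definition corrector1 (i : T) : R := Qsharp_g i - gtilde i.

Lemma corrector1E i : corrector1 i = markov_op Qchain (fun j => gtilde j + corrector1 j) i.
Proof.
rewrite /corrector1 {1}/Qsharp_g (poisson expect_center) addrC addKr.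
by apply: eq_bigr => j _; rewrite addrC subrK.
Qed.

Definition variance_g : R := sigma2 p Qs (g_pos R L c).

Lemma variance_gE :
  variance_g = stat_mean pichain (fun i => gtilde i * (2 * Qsharp_g i - gtilde i)).
Proof.
rewrite /variance_g /sigma2 expectE; apply: eq_bigr => i _; congr (_ * _).
rewrite [LHS]mxE mulmxBl mul1mx -scalemxAl -/g_centered; congr (_ * _).
by rewrite [LHS]mxE; congr (_ + _); rewrite [LHS]mxE.
Qed.

(** The source of the second Poisson equation.  Its stationary mean vanishes
exactly because of the value of [variance_g]. *)
Definition poisson_rhs : 'cV[R]_#|LL L c| :=
  \col_i (- (variance_g / 2) +
    1 * markov_op Qchain (fun j => gtilde j ^+ 2 / 2 + gtilde j * corrector1 j) i).

Lemma expect_poisson_rhs : expect p poisson_rhs = 0.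
Proof.
rewrite expectE.
transitivity (stat_mean pichain (fun i => - (variance_g / 2) + 1 *
    markov_op Qchain (fun j => gtilde j ^+ 2 / 2 + gtilde j * corrector1 j) i)).
  by apply: eq_bigr => i _; rewrite mxE.
rewrite stat_mean_affine (stat_mean_markov_op pichain_stationary) mul1r variance_gE.
have -> : stat_mean pichain (fun j => gtilde j ^+ 2 / 2 + gtilde j * corrector1 j) =
   stat_mean pichain (fun i => 0 + 2^-1 * (gtilde i * (2 * Qsharp_g i - gtilde i))).
  by apply: eq_bigr => i _; congr (_ * _); rewrite /corrector1; field.
by rewrite stat_mean_affine; field.
Qed.

Definition corrector2 (i : T) : R := (Qs *m poisson_rhs) i 0.

Lemma corrector2E i : corrector2 i + variance_g / 2 =
  markov_op Qchain (fun j => gtilde j ^+ 2 / 2 + gtilde j * corrector1 j + corrector2 j) i.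
Proof.
rewrite /corrector2 (poisson expect_poisson_rhs) [in LHS]mxE.
rewrite (_ : markov_op Qchain (fun j => _ + (Qs *m poisson_rhs) j 0) i =
  markov_op Qchain (fun j => gtilde j ^+ 2 / 2 + gtilde j * corrector1 j) i +
    markov_op Qchain (fun j => (Qs *m poisson_rhs) j 0) i);
  first by ring.
by rewrite /markov_op -big_split/=; apply: eq_bigr => j _; rewrite mulrDr.
Qed.

(** With h = Qs gtilde one has gtilde = h - Q h, and
gtilde (2 h - gtilde) = h^2 - (Q h)^2 has the stationary mean of
Q (h^2) - (Q h)^2, a conditional variance. *)
Lemma variance_g_ge0 : 0 <= variance_g.
Proof.
have E : stat_mean pichain (fun i => Qsharp_g i ^+ 2) =
  stat_mean pichain (markov_op Qchain (fun i => Qsharp_g i ^+ 2)).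
  by rewrite (stat_mean_markov_op pichain_stationary).
have HQ i : Qsharp_g i = gtilde i + markov_op Qchain Qsharp_g i by exact: (poisson expect_center).
have -> : variance_g = stat_mean pichain (fun i =>
    markov_op Qchain (fun j => Qsharp_g j ^+ 2) i - markov_op Qchain Qsharp_g i ^+ 2).
  transitivity (stat_mean pichain (fun i => Qsharp_g i ^+ 2) -
    stat_mean pichain (fun i => markov_op Qchain Qsharp_g i ^+ 2)).
    rewrite variance_gE /stat_mean -sumrB; apply: eq_bigr => i _; rewrite HQ.
    by move: (markov_op _ _ _) => ?; ring.
  by rewrite E /stat_mean -sumrB; apply: eq_bigr => i _; rewrite mulrBr.
apply: sumr_ge0 => i _; rewrite mulr_ge0 ?pichain_ge0//.
set q := markov_op Qchain Qsharp_g i.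
have : 0 <= \sum_j Qchain i j * (Qsharp_g j - q) ^+ 2.
  by apply: sumr_ge0 => j _; rewrite mulr_ge0 ?Qchain_ge0 ?sqr_ge0.
have -> : \sum_j Qchain i j * (Qsharp_g j - q) ^+ 2 =
    \sum_j Qchain i j * (q ^+ 2 + 1 * Qsharp_g j ^+ 2 + (- 2 * q) * Qsharp_g j).
  by apply: eq_bigr => j _; congr (_ * _); ring.
rewrite (mean_affine Qchain_sum) -/(markov_op Qchain Qsharp_g i) -/q
  -/(markov_op Qchain (fun j => Qsharp_g j ^+ 2) i).
by have -> : q ^+ 2 + 1 * markov_op Qchain (fun j => Qsharp_g j ^+ 2) i + -2 * q * q =
  markov_op Qchain (fun j => Qsharp_g j ^+ 2) i - q ^+ 2 by ring.
Qed.

Hypothesis hG : is_PLR L c G.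

(** The Doob transform leaves a factor phi at the first state and its inverse at
the last one. *)
Definition end_weight (i : T) : R := (phi i 0)^-1.
Definition mean_g : R := expect p (g_pos R L c).

Lemma gtildeE i : gtilde i = (0 < LLx (st i))%:R - mean_g.
Proof. by rewrite /gtilde !mxE. Qed.

Lemma sum_st (P : pred (LL L c)) (F : LL L c -> R) :
  \sum_(z | P z) F z = \sum_(i : T | P (st i)) F (st i).
Proof. exact: (reindex _ (onW_bij _ (@enum_val_bij (LL L c)))). Qed.

(** Both sides satisfy the same recursion in [n]: each step contributes
P_scale * lambda * phi i * Q i j / phi j, which is 1 if i may be followed by j
and 0 otherwise.  The chain uses the centered increments, hence the shift by
[mean_g] at each of the [n] steps. *)
Lemma value_sum_walk_op (y a : R) (f : R -> R) n i k :
  value_sum L c (fun k => f (y + a * k%:R)) n (LLj' (st i)).+1 k =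
  (P_scale * lambda) ^+ n * phi i 0 *
  iter n (walk_op Qchain gtilde a) (fun x j => f x * end_weight j)
    (y + a * k%:R + a * mean_g * n%:R) i.
Proof.
elim: n i k => [|n IH] i k.
  rewrite /value_sum /= big_nat1 /nb_nonzero/= addn0 mulr0 addr0 expr0 mul1r.
  by rewrite /end_weight mulrCA mulfV ?mulr1// gt_eqF.
rewrite (value_sum_LL hG L_gt0 c1_gt0) sum_st /= {1}/walk_op mulr_sumr big_mkcond/=.
apply: eq_bigr => j _.
rewrite QchainE P_LL_E /composable eq_sym; case: ifP => _; last by rewrite !(mulr0, mul0r).
rewrite IH gtildeE.
have -> : y + a * (k + (0 < LLx (st j)))%:R + a * mean_g * n%:R =
  y + a * k%:R + a * mean_g * n.+1%:R + a * ((0 < LLx (st j))%:R - mean_g).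
  by rewrite natrD -natr1; ring.
move: (iter n _ _ _ j) => X; rewrite exprSr invfM.
have k0 : P_scale != 0 by rewrite gt_eqF ?P_scale_gt0.
have l0 : lambda != 0 by rewrite gt_eqF ?lambda_gt0.
have p0 : phi i 0 != 0 by rewrite gt_eqF.
move: (_ ^+ n) (phi j 0) p0 k0 l0; move: (phi i 0) P_scale lambda => u v w P q u0 v0 w0.
by field; rewrite u0 v0 w0.
Qed.

(** The first of the n + 1 digits, read by the leading transition i, is nonzero:
hence the starting position a (1 - mean_g). *)
Definition leading_sum n (f : R -> R) : R := let a := (Num.sqrt n.+1%:R)^-1 in
  \sum_(i : T | leading (st i)) phi i 0 *
    iter n (walk_op Qchain gtilde a) (fun x j => f x * end_weight j) (a * (1 - mean_g)) i.

Definition normalized_nb n (N : nat) : R :=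
  ((nb_nonzero_digits L c G N)%:R - mean_g * n.+1%:R) / Num.sqrt n.+1%:R.

Lemma sum_normalized_nb n (f : R -> R) :
  \sum_(i < G n.+2 - G n.+1) f (normalized_nb n (G n.+1 + i)) =
  (P_scale * lambda) ^+ n * leading_sum n f.
Proof.
pose a := (Num.sqrt n.+1%:R)^-1 : R; pose y := - (a * mean_g * n.+1%:R).
have -> : \sum_(i < G n.+2 - G n.+1) f (normalized_nb n (G n.+1 + i)) =
  \sum_(0 <= i < G n.+2 - G n.+1)
    (fun k => f (y + a * k%:R)) (nb_nonzero_digits L c G (G n.+1 + i)).
  rewrite big_mkord; apply: eq_bigr => i _; congr f; rewrite /normalized_nb /y /a.
  by move: (_^-1) (_%:R) => ? ?; ring.
rewrite (sum_nb_nonzero_leading hG L_gt0 c1_gt0 (fun k => f (y + a * k%:R))).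
rewrite sum_st /leading_sum mulr_sumr.
apply: eq_bigr => i _; rewrite value_sum_walk_op -mulrA; congr (_ * (_ * _)).
by congr (iter _ _ _ _ _); rewrite /y -/a -natr1; ring.
Qed.

Lemma nb_accepted_gt0 n j : (0 < j <= L)%N -> (0 < nb_accepted L c n j)%N.
Proof.
elim: n j => //= n IH j /andP[j0 jL]; case: (ltnP j L) => jL'.
  by rewrite addn_gt0 IH ?orbT// jL'.
have -> : j = L by apply/eqP; rewrite eqn_leq jL jL'.
by rewrite addn0 muln_gt0 cL_gt0 IH// L_gt0.
Qed.

(** For (L, c_1) = (1, 1) the sequence G would be constant; otherwise state 1 has
a second digit below c_1, or a transition to state 2. *)
Lemma nb_integers_gt0 n : (0 < G n.+2 - G n.+1)%N.
Proof.
rewrite subn_gt0 -!(nb_accepted_G hG L_gt0) /=.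
have w1 : (0 < nb_accepted L c n 1)%N by apply: nb_accepted_gt0; rewrite L_gt0.
have [c2|c2] := ltnP 1 (c 1).
  by apply: (leq_trans _ (leq_addr _ _)); rewrite ltn_Pmull.
have c1E : c 1 = 1%N by apply/eqP; rewrite eqn_leq c2 c1_gt0.
have L1 : (1 < L)%N.
  rewrite ltn_neqAle eq_sym L_gt0 andbT; apply/eqP => LE.
  by case: hc => _ _; apply; rewrite c1E LE.
by rewrite L1 c1E mul1n -addn1 leq_add2l nb_accepted_gt0.
Qed.

(** The number of integers with n + 1 digits is the same path sum for f = 1, so
the power of lambda cancels. *)
Lemma sample_mean_normalized_nb n (f : R -> R) :
  sample_mean (G n.+2 - G n.+1) (fun i => normalized_nb n (G n.+1 + i)) f =
    leading_sum n f / leading_sum n (cst 1).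
Proof.
have kl0 : (P_scale * lambda) ^+ n != 0.
  by rewrite expf_neq0// mulf_neq0// gt_eqF ?P_scale_gt0 ?lambda_gt0.
rewrite /sample_mean sum_normalized_nb.
have := sum_normalized_nb n (cst 1); rewrite sumr_const card_ord => ->.
by rewrite invfM mulrACA mulVf// mul1r mulrC.
Qed.

Definition end_mass : R := stat_mean pichain end_weight.
Definition lead_mass : R := \sum_(i : T | leading (st i)) phi i 0.

Lemma end_mass_gt0 : 0 < end_mass.
Proof.
have [i [k _]] := hits_all.
rewrite /end_mass /stat_mean (bigD1 i)//= ltr_wpDr//.
  by apply: sumr_ge0 => j _; rewrite mulr_ge0 ?pichain_ge0// invr_ge0 ltW.
by rewrite mulr_gt0 ?invr_gt0// pichainE mulr_gt0.
Qed.

Lemma lead_mass_gt0 : 0 < lead_mass.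
Proof.
have Lc : (L, c 1) <> (1%N, 1%N) by case: hc.
have [z fz] := exists_leading L_gt0 c1_gt0 Lc.
rewrite /lead_mass (bigD1 (enum_rank z))/= ?enum_rankK//.
by rewrite ltr_wpDr// sumr_ge0// => i _; rewrite ltW.
Qed.

(** Apply [chain_clt] at the starting positions, which tend to 0 while the
heat flow of [f] is continuous. *)
Lemma cvg_leading_sum f : smooth f ->
  leading_sum n f @[n --> \oo] --> end_mass * lead_mass * heat (Num.sqrt variance_g) f 0.
Proof.
move=> sf.
pose B : R := 1 + (\sum_i `|gtilde i| + \sum_i `|corrector1 i| + \sum_i `|corrector2 i|).
have le_sum (u : T -> R) i : `|u i| <= \sum_j `|u j|.
  by rewrite (bigD1 i)//= lerDl sumr_ge0.
have s0 (u : T -> R) : 0 <= \sum_j `|u j| by rewrite sumr_ge0.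
have B1 : 1 <= B by rewrite lerDl !addr_ge0.
have gB i : `|gtilde i| <= B.
  by have := le_sum gtilde i; have := s0 corrector1; have := s0 corrector2; rewrite /B; lra.
have h1B i : `|corrector1 i| <= B.
  by have := le_sum corrector1 i; have := s0 gtilde; have := s0 corrector2; rewrite /B; lra.
have h2B i : `|corrector2 i| <= B.
  by have := le_sum corrector2 i; have := s0 corrector1; have := s0 gtilde; rewrite /B; lra.
have sgE : Num.sqrt variance_g ^+ 2 = variance_g by rewrite sqr_sqrtr// variance_g_ge0.
have [i0 [k0 hits0]] := hits_all.
have mix e (e0 : 0 < e) := mixing Qchain_sum pichain_ge0 pichain_sum pichain_stationary
  end_weight hits0 e0.
have clt := chain_clt Qchain_ge0 Qchain_sum corrector1E corrector2E B1 gB h1B h2B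
  (sqrtr_ge0 variance_g) sgE mix sf.
have acv : (Num.sqrt n.+1%:R)^-1 * (1 - mean_g) @[n --> \oo] --> (0 : R).
  rewrite -[X in _ --> X](mul0r (1 - mean_g)); apply: cvgM; last exact: cvg_cst.
  exact: cvg_inv_sqrt.
have [K [f1 [f2 TT]]] := sf.
have [cg _ _] := taylor2_continuous (heat_taylor2 (Num.sqrt variance_g) TT).
have gcv : end_mass * lead_mass *
    heat (Num.sqrt variance_g) f ((Num.sqrt n.+1%:R)^-1 * (1 - mean_g)) @[n --> \oo] -->
    end_mass * lead_mass * heat (Num.sqrt variance_g) f 0.
  by apply: cvgM; [exact: cvg_cst|exact: (cvg_comp _ _ acv (cg 0))].
rewrite -[X in _ --> X]add0r.
have -> : leading_sum ^~ f = (fun n => (leading_sum n f -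
  end_mass * lead_mass * heat (Num.sqrt variance_g) f ((Num.sqrt n.+1%:R)^-1 * (1 - mean_g))) +
  end_mass * lead_mass * heat (Num.sqrt variance_g) f ((Num.sqrt n.+1%:R)^-1 * (1 - mean_g))).
  by apply/funext => n; rewrite subrK.
apply: cvgD => //.
apply/cvgrPdist_le => e e0.
have e' : 0 < e / lead_mass by rewrite divr_gt0 ?lead_mass_gt0.
have := clt _ e'; apply: filterS => n H.
rewrite sub0r normrN /leading_sum mulrAC (mulrC _ lead_mass) mulr_suml -sumrB.
apply: le_trans (ler_norm_sum _ _ _) _.
apply: (@le_trans _ _ (\sum_(i : T | leading (st i)) phi i 0 * (e / lead_mass))).
  apply: ler_sum => i _; rewrite -mulrBr normrM gtr0_norm// ler_pM2l//.
by rewrite -mulr_suml -/lead_mass mulrC divfK// gt_eqF ?lead_mass_gt0.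
Qed.

Lemma cvg_sample_mean_normalized_nb f : smooth f ->
  sample_mean (G n.+2 - G n.+1) (fun i => normalized_nb n (G n.+1 + i)) f @[n --> \oo] -->
  \int[normal0 variance_g]_x f x.
Proof.
move=> sf; have [K [f1 [f2 TT]]] := sf; rewrite (Rintegral_normal0 TT variance_g_ge0).
under eq_fun do rewrite sample_mean_normalized_nb.
have mP0 : end_mass * lead_mass != 0 by rewrite gt_eqF// mulr_gt0 ?end_mass_gt0 ?lead_mass_gt0.
have c1 := cvg_leading_sum (smooth_cst 1).
have g1 : heat (Num.sqrt variance_g) (cst 1) 0 = 1 :> R by exact: gauss_cst.
rewrite g1 mulr1 in c1.
have cf := cvg_leading_sum sf.
have -> : heat (Num.sqrt variance_g) f 0 =
  end_mass * lead_mass * heat (Num.sqrt variance_g) f 0 / (end_mass * lead_mass).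
  by rewrite mulrAC mulfV// mul1r.
by apply: cvgM => //; exact: cvgV.
Qed.

Lemma cvg_in_law_normalized_nb : cvg_in_law (Q_unif R G) normalized_nb (normal0 variance_g).
Proof.
move=> f cf bf; under eq_fun do rewrite Rintegral_Q_unif.
exact: (weak_cvg_of_smooth nb_integers_gt0 cvg_sample_mean_normalized_nb cf bf).
Qed.

Lemma mean_gE : mean_g = 1 - pi_Q1 p 0.
Proof.
rewrite /mean_g expectE /pi_Q1 -pichain_sum /stat_mean.
rewrite [in RHS](bigID (fun i => LLx (st i) == 0%N))/=.
rewrite addrC addrK [in RHS]big_mkcond/=; apply: eq_bigr => i _.
by rewrite mxE lt0n; case: (LLx _ == _); rewrite ?mulr0 ?mulr1.
Qed.

(** A deviation by n eps moves the normalized variable beyond any fixed bound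
once n is large, an event detected by [tail_test]. *)
Lemma cvg_Q_unif_deviation (eps : R) : 0 < eps ->
  Q_unif R G n [set N | n%:R * eps < `|(nb_nonzero_digits L c G N)%:R - mean_g * n.+1%:R|]
    @[n --> \oo] --> 0%E.
Proof.
move=> eps0.
under eq_fun do rewrite Q_unif_set.
apply: cvg_EFin; first by near=> n.
apply/cvgrPdist_le => e e0.
have e2 : 0 < e / 2 by lra.
have [B B0 tB] := tail_small (normal0 variance_g) e2.
have st := cvg_sample_mean_normalized_nb (smooth_tail_test B).
have /cvgrPdist_le/(_ _ e2) ct := st.
have eB : 0 < eps / (2 * (B + 3)) by rewrite divr_gt0// mulr_gt0//; lra.
have /cvgrPdist_le/(_ _ eB) sq := @cvg_inv_sqrt R.
near=> n.
have n1 : (0 < n)%N by near: n; exact: nbhs_infty_gt.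
have : `|\int[normal0 variance_g]_x tail_test B x -
  sample_mean (G n.+2 - G n.+1) (fun i => normalized_nb n (G n.+1 + i)) (tail_test B)|
    <= e / 2 by near: n.
have : `|0 - (Num.sqrt (n.+1%:R : R))^-1| <= eps / (2 * (B + 3)) by near: n.
set r := (Num.sqrt _)^-1; have r0 : 0 < r by rewrite invr_gt0 sqrtr_gt0.
move=> rB h; rewrite sub0r normrN (gtr0_norm r0) in rB.
have rr : n.+1%:R * r ^+ 2 = 1 by rewrite exprVn sqr_sqrtr// divff.
have big : B + 3 <= n%:R * eps * r.
  rewrite ler_pdivlMr in rB; last by lra.
  have nn : n.+1%:R <= 2 * n%:R :> R by rewrite -natrM ler_nat mul2n -addnn -addn1 leq_add2l.
  rewrite -(ler_pM2l r0).
  have -> : r * (n%:R * eps * r) = n%:R * r ^+ 2 * eps by ring.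
  have : 1 <= 2 * (n%:R * r ^+ 2) by rewrite -[leLHS]rr mulrA ler_wpM2r ?sqr_ge0.
  by move: (n%:R * r ^+ 2) => u u1; nra.
rewrite sub0r normrN /=.
have dom N : \1_[set N | n%:R * eps < `|(nb_nonzero_digits L c G N)%:R - mean_g * n.+1%:R|] N
    <= tail_test B (normalized_nb n N) :> R.
  rewrite indicE; have [|_] := boolP (N \in _); last exact: tail_test_ge0.
  rewrite inE /= => Nn; apply: tail_test_out; apply: (le_trans big).
  by rewrite /normalized_nb normrM -/r (gtr0_norm r0) ler_pM2r// ltW.
rewrite ger0_norm; last by rewrite mulr_ge0 ?invr_ge0// sumr_ge0.
apply: (@le_trans _ _ (sample_mean (G n.+2 - G n.+1)
  (fun i => normalized_nb n (G n.+1 + i)) (tail_test B))).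
  by rewrite /sample_mean ler_wpM2l ?invr_ge0// ler_sum.
move: h; rewrite distrC => /(le_trans (ler_norm _)); lra.
Unshelve. all: by end_near. Qed.

End Perron.
End Automaton.

Theorem corollary3p5 (R : realType) (L : nat) (c G : nat -> nat)
  (hc : PLR_coef L c) (hG : is_PLR L c G)
  (lambda : R) (nu : 'rV[R]_#|LL L c|) (phi : 'cV[R]_#|LL L c|)
  (hperron : is_perron_data (P_LL R L c) lambda nu phi)
  (Qs : 'M[R]_#|LL L c|)
  (hQs : is_Qsharp (doob_transform (P_LL R L c) lambda phi) (pi_Q nu phi) Qs) :
  let k := nb_nonzero_digits L c G in
  let CLek := 1 - pi_Q1 (pi_Q nu phi) 0 in
  let s2 := sigma2 (pi_Q nu phi) Qs (g_pos R L c) in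
  (forall eps : R, 0 < eps ->
     Q_unif R G n [set N | n%:R * eps < `|(k N)%:R - CLek * n.+1%:R|]
       @[n --> \oo] --> 0%E)
  /\
  cvg_in_law (Q_unif R G)
    (fun n N => ((k N)%:R - CLek * n.+1%:R) / Num.sqrt n.+1%:R)
    (normal0 s2).
Proof.
have [_ [nuA Aphi] [nu0 phi0] _ nuphi] := hperron.
move=> k CLek s2'.
have CE : mean_g nu phi = CLek by exact: mean_gE.
split; rewrite -CE.
  exact: (cvg_Q_unif_deviation hc nuA Aphi nu0 phi0 nuphi hQs hG).
exact: (cvg_in_law_normalized_nb hc nuA Aphi nu0 phi0 nuphi hQs hG).
Qed.
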